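(* Let $G$ be a finite group, let $A$ be a $C^*$-algebra, and let $\alpha$ be a partial action of $G$ on $A$. Then there are canonical equivariant extensions $$0\to (D^{(k)},\delta^{(k)})\to (A^{(k)},\alpha^{(k)})\to (A^{(k-1)},\alpha^{(k-1)})\to 0,$$ for $2\le k\le |G|$, with $(A^{(|G|)},\alpha^{(|G|)})=(A,\alpha)$, satisfying the following properties: (a) $\delta^{(k)}$ has the $k$-decomposition property; (b) $A^{(k)}_\sigma=\{0\}$ for all $\sigma\in\mathcal{T}_{k+1}(G)$; (c) $\alpha^{(1)}$ has the $1$-decomposition property. Thus $\alpha$ can be written canonically as an iterated extension of decomposable partial actions.
   Context: Partial actions: a partial action $\alpha=((A_g)_{g\in G},(\alpha_g)_{g\in G})$ of a discrete group $G$ on a $C^*$-algebra $A$ consists of closed two-sided ideals $A_g$ of $A$ and $*$-isomorphisms $\alpha_g\colon A_{g^{-1}}\to A_g$ such that $A_1=A$, $\alpha_1=\mathrm{id}_A$, and $\alpha_{gh}$ extends $\alpha_g\circ\alpha_h$ wherever the composition is defined. Equivariant extensions: an ideal $I$ of $A$ is $G$-invariant if $\alpha_g(I\cap A_{g^{-1}})\subseteq I$ for all $g$. Then $\alpha$ restricts to a partial action on $I$ with domains $I\cap A_g$, and induces a partial action on $A/I$ whose domains are the images of the $A_g$. An equivariant extension $0\to(D,\delta)\to(A,\alpha)\to(B,\beta)\to0$ is an extension of $C^*$-algebras in which $D$ is (identified with) a $G$-invariant ideal of $A$, $\delta$ is the restriction of $\alpha$ to $D$, and $(B,\beta)$ is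 the quotient $A/D$ with the induced partial action. Decomposition property: for $n\in\mathbb{N}=\{1,2,\ldots\}$ let $\mathcal{T}_n(G)=\{\tau\subseteq G\colon 1\in\tau,\ |\tau|=n\}$ (empty if $n>|G|$), and for a partial action on $A$ set $A_\tau=\bigcap_{g\in\tau}A_g$. A partial action has the $n$-decomposition property if (a) $A=\overline{\sum_{\tau\in\mathcal{T}_n(G)}A_\tau}$, and (b) $A_\tau\cap A_g=\{0\}$ for all $\tau\in\mathcal{T}_n(G)$ and all $g\in G\setminus\tau$. It is decomposable if it has the $n$-decomposition property for some $n$. In the claim, $A^{(k)}_\sigma=\bigcap_{g\in\sigma}A^{(k)}_g$, where $A^{(k)}_g$ are the domains of $\alpha^{(k)}$. *)

(* Defs.v *)
From HB Require Import structures.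
From mathcomp Require Import all_boot all_order all_algebra all_fingroup.
From mathcomp Require Import complex.
From mathcomp Require Import all_classical all_reals all_analysis.

Set Implicit Arguments.
Unset Strict Implicit.
Unset Printing Implicit Defensive.

Import Order.TTheory GRing.Theory Num.Theory.
Import numFieldNormedType.Exports.

Local Open Scope classical_set_scope.
Local Open Scope complex_scope.
Local Open Scope ring_scope.

(* A C*-algebra is a complex Banach space with a product and an involution.
   Since ideals and quotients must again be C*-algebras, no unit is required
   (which rules out the unital algType of ssralg) and the zero algebra is
   allowed.  The norm of normedModType R[i] takes its values in the nonnegative
   reals of R[i]. *)
HB.mixin Record CompleteNormedModule_isCStarAlgebra (R : realType) A
    & CompleteNormedModule R[i] A := {
  cmul : A -> A -> A ;
  cstar : A -> A ;
  cmulA : associative cmul ;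
  cmulDl : left_distributive cmul +%R ;
  cmulDr : right_distributive cmul +%R ;
  cmulZl : forall (c : R[i]) (x y : A), cmul (c *: x) y = c *: cmul x y ;
  cmulZr : forall (c : R[i]) (x y : A), cmul x (c *: y) = c *: cmul x y ;
  cstarD : forall x y : A, cstar (x + y) = cstar x + cstar y ;
  cstarZ : forall (c : R[i]) (x : A), cstar (c *: x) = Num.conj c *: cstar x ;
  cstarM : forall x y : A, cstar (cmul x y) = cmul (cstar y) (cstar x) ;
  cstarK : involutive cstar ;
  cnormM : forall x y : A, `|cmul x y| <= `|x| * `|y| ;
  cnorm_star : forall x : A, `|cmul (cstar x) x| = `|x| ^+ 2
}.

#[short(type="cstarAlgType")]
HB.structure Definition CStarAlgebra (R : realType) :=
  {A of CompleteNormedModule R[i] A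
      & CompleteNormedModule_isCStarAlgebra R A}.

Record closed_ideal (R : realType) (A : cstarAlgType R) (I : set A) : Prop := {
  ideal_closed : closed I ;
  ideal0 : I 0 ;
  idealD : forall x y, I x -> I y -> I (x + y) ;
  idealZ : forall (c : R[i]) x, I x -> I (c *: x) ;
  idealMl : forall a x, I x -> I (cmul a x) ;
  idealMr : forall a x, I x -> I (cmul x a)
}.

(* No continuity is required: it is automatic for *-homomorphisms between
   C*-algebras. *)
Record star_hom_on (R : realType) (A B : cstarAlgType R) (I : set A)
    (f : A -> B) : Prop := {
  star_homD : forall x y, I x -> I y -> f (x + y) = f x + f y ;
  star_homZ : forall (c : R[i]) x, I x -> f (c *: x) = c *: f x ;
  star_homM : forall x y, I x -> I y -> f (cmul x y) = cmul (f x) (f y) ;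
  star_homS : forall x, I x -> f (cstar x) = cstar (f x)
}.

Definition star_hom (R : realType) (A B : cstarAlgType R) (f : A -> B) : Prop :=
  star_hom_on setT f.

(* pact g is a total function of which only the restriction to pdom g^-1 is
   meaningful; its values elsewhere are unconstrained. *)
Record partial_action (G : finGroupType) (R : realType)
    (A : cstarAlgType R) : Type := PartialAction {
  pdom : G -> set A ;
  pact : G -> A -> A ;
  pdom_ideal : forall g, closed_ideal (pdom g) ;
  pact_bij : forall g, set_bij (pdom g^-1%g) (pdom g) (pact g) ;
  pact_hom : forall g, star_hom_on (pdom g^-1%g) (pact g) ;
  pdom1 : pdom 1%g = setT ;
  pact1 : forall x, pact 1%g x = x ;
  pactM : forall g h x,
    pdom h^-1%g x -> pdom g^-1%g (pact h x) ->
    pdom ((g * h)^-1)%g x /\ pact (g * h)%g x = pact g (pact h x)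
}.

Record pasystem (G : finGroupType) (R : realType) : Type := PASystem {
  pasys_alg :> cstarAlgType R ;
  paction : partial_action G pasys_alg
}.

Definition padom (G : finGroupType) (R : realType) (S : pasystem G R) :
  G -> set S := pdom (paction S).

Definition paact (G : finGroupType) (R : realType) (S : pasystem G R) :
  G -> S -> S := pact (paction S).

Definition pa_invariant (G : finGroupType) (R : realType) (S : pasystem G R)
    (I : set S) : Prop :=
  forall g x, I x -> padom g^-1%g x -> I (paact g x).

Definition equivariant_hom (G : finGroupType) (R : realType)
    (S T : pasystem G R) (f : S -> T) : Prop :=
  [/\ star_hom f,
      forall g, f @` padom g `<=` padom g
    & forall g x, padom g^-1%g x -> f (paact g x) = paact g (f x)].

(* The short exact sequence 0 -> D -i-> A -p-> B -> 0: the injection i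
   identifies D with an invariant ideal of A, and p identifies B with A / D. *)
Record equivariant_extension (G : finGroupType) (R : realType)
    (D A B : pasystem G R) (i : D -> A) (p : A -> B) : Prop := {
  ext_incl_hom : star_hom i ;
  ext_incl_inj : injective i ;
  ext_proj_hom : star_hom p ;
  ext_proj_surj : range p = setT ;
  ext_exact : range i = p @^-1` [set 0] ;
  ext_ideal : closed_ideal (range i) ;
  ext_invariant : pa_invariant (range i) ;
  ext_sub_dom : forall g, i @` padom g = range i `&` padom g ;
  ext_sub_act : forall g x, padom g^-1%g x -> i (paact g x) = paact g (i x) ;
  ext_quo_dom : forall g, p @` padom g = padom g ;
  ext_quo_act : forall g x, padom g^-1%g x -> p (paact g x) = paact g (p x)
}.

Definition ptuples (G : finGroupType) (n : nat) : {set {set G}} :=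
  [set tau : {set G} | (1%g \in tau) && (#|tau| == n)]%SET.

Definition padomI (G : finGroupType) (R : realType) (S : pasystem G R)
    (tau : {set G}) : set S :=
  \bigcap_(g in [set g | g \in tau]) padom g.

Definition sum_padomI (G : finGroupType) (R : realType) (S : pasystem G R)
    (n : nat) : set S :=
  [set \sum_(tau in ptuples G n) x tau | x in
    [set x : {set G} -> S |
      forall tau, tau \in ptuples G n -> padomI tau (x tau)]].

Definition decomposition_property (G : finGroupType) (R : realType)
    (n : nat) (S : pasystem G R) : Prop :=
  closure (@sum_padomI G R S n) = setT /\
  forall (tau : {set G}) (g : G), tau \in ptuples G n -> g \notin tau ->
    padomI tau `&` padom g = [set 0 : S].

Definition decomposable (G : finGroupType) (R : realType)
    (S : pasystem G R) : Prop :=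
  exists2 n, (0 < n)%N & decomposition_property n S.

Inductive iterated_extension (G : finGroupType) (R : realType)
    (P : pasystem G R -> Prop) : pasystem G R -> Prop :=
| iterated_base (S : pasystem G R) : P S -> iterated_extension P S
| iterated_step (D A B : pasystem G R) (i : D -> A) (p : A -> B) :
    P D -> iterated_extension P B -> equivariant_extension i p ->
    iterated_extension P A.

(* The extension 0 -> D^(k) -> A^(k) -> A^(k-1) -> 0 has D^(k) = tker k,
   A^(k) = tsys k and maps tincl k.-1, tproj k.-1; the shift avoids the
   predecessor in the types.  Entries with k outside the range 1 <= k <= |G|
   (2 <= k <= |G| for tker) are unconstrained. *)
Record tower (G : finGroupType) (R : realType) : Type := Tower {
  tsys : nat -> pasystem G R ;
  tker : nat -> pasystem G R ;
  tincl : forall k, tker k.+1 -> tsys k.+1 ;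
  tproj : forall k, tsys k.+1 -> tsys k
}.

Record decomposition_tower (G : finGroupType) (R : realType)
    (S : pasystem G R) (T : tower G R) : Prop := {
  tower_top : tsys T #|G| = S ;
  tower_ext : forall k, (0 < k < #|G|)%N ->
    equivariant_extension (@tincl G R T k) (@tproj G R T k) ;
  tower_ker : forall k, (2 <= k <= #|G|)%N ->
    decomposition_property k (tker T k) ;
  tower_vanish : forall k, (2 <= k <= #|G|)%N ->
    forall sigma, sigma \in ptuples G k.+1 ->
    padomI sigma = [set 0 : tsys T k] ;
  tower_bottom : decomposition_property 1 (tsys T 1)
}.

Record tower_morphism (G : finGroupType) (R : realType) (T T' : tower G R)
    (f : forall k, tsys T k -> tsys T' k)
    (d : forall k, tker T k -> tker T' k) : Prop := {
  tower_mor_sys : forall k, (0 < k <= #|G|)%N -> equivariant_hom (f k) ;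
  tower_mor_ker : forall k, (2 <= k <= #|G|)%N -> equivariant_hom (d k) ;
  tower_mor_incl : forall k, (0 < k < #|G|)%N ->
    forall x, f k.+1 (tincl x) = tincl (d k.+1 x) ;
  tower_mor_proj : forall k, (0 < k < #|G|)%N ->
    forall x, f k (tproj x) = tproj (f k.+1 x)
}.

Definition extends_uniquely (G : finGroupType) (R : realType)
    (T T' : tower G R) (phi : tsys T #|G| -> tsys T' #|G|) : Prop :=
  exists (f : forall k, tsys T k -> tsys T' k)
         (d : forall k, tker T k -> tker T' k),
    [/\ f #|G| =1 phi,
        tower_morphism f d
      & forall (f' : forall k, tsys T k -> tsys T' k)
               (d' : forall k, tker T k -> tker T' k),
          f' #|G| =1 phi -> tower_morphism f' d' ->
          (forall k, (0 < k <= #|G|)%N -> f' k =1 f k) /\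
          (forall k, (2 <= k <= #|G|)%N -> d' k =1 d k)].

(* Canonicity, made precise as functoriality in (A, alpha).  For phi the
   identity it says that any two towers of the same partial action are
   isomorphic by a unique isomorphism. *)
Definition canonical_towers (G : finGroupType) (R : realType)
    (S : pasystem G R) : Prop :=
  forall (S' : pasystem G R) (T T' : tower G R),
    decomposition_tower S T -> decomposition_tower S' T' ->
    forall phi : tsys T #|G| -> tsys T' #|G|,
      equivariant_hom phi -> extends_uniquely phi.

(* Main.v *)
Require Import Defs.
From HB Require Import structures.
From mathcomp Require Import all_boot all_order all_algebra all_fingroup.
From mathcomp Require Import complex.
From mathcomp Require Import all_classical all_reals all_analysis.
From mathcomp Require Import ring lra.

(** Call the closed span [layer n] of the ideals [padomI tau], [tau] of size [n]
    and containing 1, the n-th layer.  Suppose that [padomI sigma] vanishes as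
    soon as [sigma] has [n.+1] elements (for [n = #|G|] there is no such
    [sigma]).  The action of [g] sends an element of [padomI tau] that lies in
    its domain into [padomI (g tau)] if [g^-1] is in [tau], and such an element
    is 0 otherwise because it lies in the intersection over [g^-1 |: tau].  So
    the layer is invariant ([layer_invariant]).  Restricted to it, the action has
    the n-decomposition property ([layer_decomposition]).  On the quotient by it
    the intersections over [n] elements vanish ([vanishing_quo]), since forming
    quotients commutes with finite intersections of ideals ([quo_padomI]).
    Iterating from [n = #|G|] down to 2 gives the tower ([peeling_towerP]).

    Conversely, in an extension whose kernel has the n-decomposition property
    and whose quotient has vanishing n-fold intersections, the kernel must be
    the n-th layer ([ext_kernel_layer]).  A *-homomorphism is contractive
    ([star_hom_contr]), so an equivariant one maps layers into layers and
    descends step by step along two towers ([tower_maps]).  That is canonicity.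

    Apart from contractivity, the facts on C*-algebras behind this come from the
    resolvent of a single self-adjoint element [k].  In the operator norm [1 + i t k] is at most
    [sqrt (1 + t ^ 2 |k| ^ 2)], by the C*-identity; hence [1 - i s k] is bounded
    below by 1, and it is invertible by a contraction argument.  With
    [k = d d^*] and large [s] the inverse is [1 + e], a contraction with [e] in
    every ideal containing [d], and [d + e d] is small
    ([approximate_unit_at]).  This local approximate unit shows that closed
    ideals are self-adjoint, that quotient norms are C*-norms, that sums of two
    closed ideals are closed, and that intersecting ideals commutes with
    quotients.  Contractivity of *-homomorphisms needs no spectral radius
    formula: if [|h| = 1] then [1 - h ^ 2] has no bounded inverse,
    because the products of the factors [1 + h ^ (2 ^ j)], [1 <= j <= m], have
    norm at least [2 ^ m] after multiplication by [h]. *)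

Set Implicit Arguments.
Unset Strict Implicit.
Unset Printing Implicit Defensive.

Import Order.TTheory GRing.Theory Num.Theory.
Import numFieldNormedType.Exports.
Import Defs.

Local Open Scope classical_set_scope.
Local Open Scope complex_scope.
Local Open Scope ring_scope.

(** * Real-valued norms and geometric convergence *)

Section RealNorm.
Context (R : realType).

(** The norm of a complex normed module has values in [R[i]]; inequalities are
    handled through this copy in the real field. *)
Definition rnorm (V : normedModType R[i]) (x : V) : R := complex.Re `|x|.

Context (V : normedModType R[i]).
Implicit Types x y : V.

Lemma normE x : `|x| = (rnorm x)%:C.
Proof. by rewrite /rnorm RRe_real// normr_real. Qed.

Lemma rnorm_ge0 x : 0 <= rnorm x.
Proof. by rewrite -ler0c -normE. Qed.

Lemma rnorm_eq0 x : rnorm x = 0 -> x = 0.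
Proof. by move=> x0; apply/normr0_eq0; rewrite normE x0. Qed.

Lemma rnorm0 : rnorm (0 : V) = 0.
Proof. by rewrite /rnorm normr0. Qed.

Lemma rnormN x : rnorm (- x) = rnorm x.
Proof. by rewrite /rnorm normrN. Qed.

Lemma rdistC x y : rnorm (x - y) = rnorm (y - x).
Proof. by rewrite -rnormN opprB. Qed.

Lemma rnormD x y : rnorm (x + y) <= rnorm x + rnorm y.
Proof. by rewrite -lecR rmorphD/= -!normE ler_normD. Qed.

Lemma rnormB x y : rnorm (x - y) <= rnorm x + rnorm y.
Proof. by rewrite -(rnormN y) rnormD. Qed.

Lemma rdistD z x y : rnorm (x - y) <= rnorm (x - z) + rnorm (z - y).
Proof. by have := rnormD (x - z) (z - y); rewrite addrA subrK. Qed.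

Lemma rnormZ (c : R[i]) x : rnorm (c *: x) = complex.Re `|c| * rnorm x.
Proof.
by apply: complexI; rewrite rmorphM/= -!normE normrZ; congr (_ * _).
Qed.

Lemma rnormZr (a : R) x : 0 <= a -> rnorm (a%:C *: x) = a * rnorm x.
Proof.
by move=> a0; rewrite rnormZ normc_def/= expr0n addr0 sqrtr_sqr ger0_norm.
Qed.

Lemma rnormZi (a : R) x : 0 <= a -> rnorm ((a *i) *: x) = a * rnorm x.
Proof.
by move=> a0; rewrite rnormZ normc_def/= expr0n add0r sqrtr_sqr ger0_norm.
Qed.

Lemma nbhs_rnormP x (U : set V) :
  nbhs x U <-> exists2 e : R, 0 < e & forall y, rnorm (x - y) < e -> U y.
Proof.
split=> [/nbhs_ballP[e/= e0 eU]|[e e0 eU]].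
  have eE : e = (complex.Re e)%:C by rewrite RRe_real// ger0_real// ltW.
  exists (complex.Re e); first by rewrite -ltcR -eE.
  by move=> y xy; apply: eU; rewrite -ball_normE/= normE eE ltcR.
apply/nbhs_ballP; exists e%:C => /=; first by rewrite ltcR.
by move=> y; rewrite -ball_normE/= normE ltcR; exact: eU.
Qed.

Lemma closure_rnormP (X : set V) x :
  closure X x <-> forall e : R, 0 < e -> exists2 y, X y & rnorm (x - y) < e.
Proof.
split=> [cX e e0|h U /nbhs_rnormP[e e0 eU]].
  have [|y [Xy xy]] := cX [set y | rnorm (x - y) < e]; last by exists y.
  by apply/nbhs_rnormP; exists e.
by have [y Xy /eU Uy] := h e e0; exists y.
Qed.

Lemma closed_rnormP (X : set V) : closed X <->
  forall x, (forall e : R, 0 < e -> exists2 y, X y & rnorm (x - y) < e) -> X x.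
Proof.
by split=> cX x; [move/closure_rnormP/cX|move/closure_rnormP; exact: cX].
Qed.

End RealNorm.

Lemma geometric_small (R : realType) (rho C e : R) :
  0 <= rho -> rho < 1 -> 0 <= C -> 0 < e -> exists n, C * rho ^+ n < e.
Proof.
move=> r0 r1 C0 e0.
have : (fun n => C * rho ^+ n) @ \oo --> (0 : R).
  rewrite -[X in _ --> X](mulr0 C); apply: cvgMr.
  by apply: cvg_expr; rewrite ger0_norm.
move/cvgrPdist_lt => /(_ e e0)[n _ /(_ n (leqnn n))]/=.
rewrite sub0r normrN ger0_norm; first by exists n.
by rewrite mulr_ge0// exprn_ge0.
Qed.

Section Geometric.
Context (R : realType) (V : normedModType R[i]) (u : nat -> V) (C rho : R).
Hypotheses (rho0 : 0 <= rho) (rho1 : rho < 1) (C0 : 0 <= C).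
Hypothesis u_step : forall n, rnorm (u n.+1 - u n) <= C * rho ^+ n.

Lemma geometric_dist n m : (n <= m)%N ->
  rnorm (u m - u n) <= C / (1 - rho) * rho ^+ n.
Proof.
have r1 : 0 < 1 - rho by rewrite subr_gt0.
move=> /subnK <-; move: (m - n)%N => d; elim: d n => [|d ih] n.
  by rewrite add0n subrr rnorm0 mulr_ge0 ?exprn_ge0// divr_ge0// ltW.
rewrite addSnnS (le_trans (rdistD (u n.+1) _ _))//.
rewrite (le_trans (lerD (ih _) (u_step _)))// exprS.
rewrite [leRHS](_ : _ = C / (1 - rho) * (rho * rho ^+ n) + C * rho ^+ n)//.
by field; rewrite gt_eqF.
Qed.

End Geometric.

(** The bound on the distance to the limit is the tail of the geometric series
    that dominates the increments. *)
Lemma geometric_cvg (R : realType) (V : completeNormedModType R[i])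
    (u : nat -> V) (C rho : R) : 0 <= rho -> rho < 1 -> 0 <= C ->
    (forall n, rnorm (u n.+1 - u n) <= C * rho ^+ n) ->
  exists l, forall n, rnorm (l - u n) <= C / (1 - rho) * rho ^+ n.
Proof.
move=> r0 r1 C0 ustep; have ud := geometric_dist r0 r1 C0 ustep.
have r1' : 0 < 1 - rho by rewrite subr_gt0.
have D0 : 0 <= C / (1 - rho) by rewrite divr_ge0// ltW.
have : cauchy (u @ \oo).
  apply: cauchy_exP => e e0.
  have eE : e = (complex.Re e)%:C by rewrite RRe_real// ger0_real// ltW.
  have re0 : 0 < complex.Re e by rewrite -ltcR -eE.
  have [n ne] := geometric_small r0 r1 D0 re0.
  exists (u n), n => // m /= nm.
  by rewrite -ball_normE/= normE eE ltcR rdistC (le_lt_trans _ ne)// ud.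
move/cauchy_cvg/cvg_ex => [l ul]; exists l => n.
apply/ler_addgt0Pr => e e0.
have : nbhs l [set y | rnorm (l - y) < e] by apply/nbhs_rnormP; exists e.
move/ul => [m _ mP].
have /= h := mP (maxn n m) (leq_maxr _ _).
rewrite (le_trans (rdistD (u (maxn n m)) _ _))// addrC lerD//; last exact: ltW.
by apply: ud; rewrite leq_maxl.
Qed.

(** Banach's fixed point theorem, for scalars in [R[i]]. *)
Lemma contraction_fixpoint (R : realType) (V : completeNormedModType R[i])
    (f : V -> V) (rho : R) : 0 <= rho -> rho < 1 ->
    (forall x y, rnorm (f x - f y) <= rho * rnorm (x - y)) ->
  exists x, f x = x.
Proof.
move=> r0 r1 fr; pose u n := iter n f 0.
have [|l lP] := @geometric_cvg _ _ u _ _ r0 r1 (rnorm_ge0 (u 1%N - u 0%N)).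
  elim=> [|n ih]; first by rewrite expr0 mulr1.
  by rewrite (le_trans (fr _ _))// exprS mulrCA ler_wpM2l.
exists l; apply/eqP; rewrite -subr_eq0; apply/eqP/rnorm_eq0/le_anti.
rewrite rnorm_ge0 andbT; apply/ler_addgt0Pr => e e0; rewrite add0r.
have r1' : 0 < 1 - rho by rewrite subr_gt0.
have D0 : 0 <= rnorm (u 1%N - u 0%N) / (1 - rho).
  by rewrite divr_ge0 ?rnorm_ge0// ltW.
have [n ne] := geometric_small r0 r1 D0 (divr_gt0 e0 (ltr0n R 2)).
rewrite (le_trans (rdistD (u n.+1) _ _))// [e]splitr lerD//.
  rewrite (le_trans (fr _ _))//; apply: le_trans (ltW ne).
  rewrite (le_trans _ (lP n))// ler_piMl ?rnorm_ge0// ltW//.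
rewrite rdistC (le_trans (lP _))// (le_trans _ (ltW ne))// ler_wpM2l//.
by rewrite exprS ler_piMl ?exprn_ge0// ltW.
Qed.

(** Completeness, which is about Cauchy filters, follows from the convergence of
    fast Cauchy sequences: pick a point in a member of the filter of radius
    [2^-1 ^+ n] for each [n]. *)
Lemma complete_of_geometric (R : realType) (V : normedModType R[i]) (K : R) :
    0 <= K ->
    (forall u : nat -> V, (forall n, rnorm (u n.+1 - u n) <= 2 * 2^-1 ^+ n) ->
      exists l, forall n, rnorm (l - u n) <= K * 2^-1 ^+ n) ->
  forall F : set_system V, ProperFilter F -> cauchy F -> cvg F.
Proof.
move=> K0 lims F FF /cauchyP Fcauchy.
have half0 : 0 <= 2^-1 :> R by [].
have half1 : 2^-1 < 1 :> R by rewrite invf_lt1// ltr1n.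
pose q n : R := 2^-1 ^+ n.
have q0 n : 0 < q n by rewrite exprn_gt0// invr_gt0.
have ballE (x y : V) (e : R) : ball x e%:C y = (rnorm (x - y) < e) :> Prop.
  by rewrite -ball_normE/= normE ltcR.
have /choice[u uP] n : exists x, F (ball x (q n)%:C).
  by have [|x Fx] := Fcauchy (q n)%:C; [rewrite ltcR|exists x].
have [n|l lP] := lims u.
  have [y []] := filter_ex (filterI (uP n.+1) (uP n)).
  rewrite !ballE => y1 y2; rewrite (le_trans (rdistD y _ _))//.
  rewrite mulr_natl mulr2n -/(q n) lerD//; last by rewrite rdistC ltW.
  by rewrite (le_trans (ltW y1))// /q exprS ler_piMl ?(ltW half1)// (ltW (q0 n)).
apply/cvg_ex; exists l; apply/fcvgrPdist_lt => e e0.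
have eE : e = (complex.Re e)%:C by rewrite RRe_real// ger0_real// ltW.
have re0 : 0 < complex.Re e by rewrite -ltcR -eE.
have K1 : 0 <= K + 1 by exact: addr_ge0.
have [n ne] := geometric_small half0 half1 K1 re0.
apply: filterS (uP n) => y; rewrite ballE => uy.
rewrite eE normE ltcR (le_lt_trans (rdistD (u n) _ _))//.
apply: le_lt_trans ne; rewrite mulrDl mul1r; apply: lerD; first exact: lP.
exact: ltW uy.
Qed.

(** * Calculus in a C*-algebra and local approximate units *)

Local Notation "a · b" := (cmul a b) (at level 40, left associativity).

Section ComplexScalars.
Context (R : realType).
Implicit Types a b : R.

Lemma mulc_re_im a b : a%:C * b*i = (a * b)*i.
Proof. by apply/eqP; rewrite eq_complex /= !mul0r subr0 addr0 mulr0 !eqxx. Qed.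

Lemma mulc_im_re a b : a*i * b%:C = (a * b)*i.
Proof. by rewrite mulrC mulc_re_im mulrC. Qed.

Lemma mulc_im_im a b : a*i * b*i = - (a * b)%:C.
Proof.
by apply/eqP; rewrite eq_complex /= !mul0r mulr0 sub0r addr0 oppr0 !eqxx.
Qed.

Lemma conj_im a : Num.conj (a *i) = - (a *i).
Proof.
have [->|a0] := eqVneq a 0; first by rewrite -[0*i]/(0 : R[i]) conjC0 oppr0.
have ai0 : a*i != 0 by rewrite eq_complex/= negb_and a0 orbT.
apply: (mulfI ai0); rewrite -normCK normc_def/= expr0n add0r sqrtr_sqr.
by rewrite mulrN mulc_im_im opprK -rmorphXn/= real_normK ?num_real// expr2.
Qed.

Lemma le_of_sqr a b : 0 <= b -> a ^+ 2 <= b ^+ 2 -> a <= b.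
Proof.
move=> b0 ab; rewrite (le_trans (ler_norm a))//.
by rewrite -(@ler_pXn2r _ 2)// real_normK ?num_real.
Qed.

End ComplexScalars.

Lemma subrACA (V : zmodType) (x y z t : V) : x - y - (z - t) = x - z - (y - t).
Proof. by rewrite !opprD addrACA. Qed.

Section CStarCalculus.
Context (R : realType) (A : cstarAlgType R).
Implicit Types (x y z k d e : A) (a b s : R).

Lemma cmul0r x : 0 · x = 0.
Proof. by have := cmulZl 0 0 x; rewrite !scale0r. Qed.

Lemma cmulr0 x : x · 0 = 0.
Proof. by have := cmulZr 0 x 0; rewrite !scale0r. Qed.

Lemma cmulNl x y : (- x) · y = - (x · y).
Proof. by rewrite -scaleN1r cmulZl scaleN1r. Qed.

Lemma cmulNr x y : x · (- y) = - (x · y).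
Proof. by rewrite -scaleN1r cmulZr scaleN1r. Qed.

Lemma cmulBl x y z : (x - y) · z = x · z - y · z.
Proof. by rewrite cmulDl cmulNl. Qed.

Lemma cmulBr x y z : z · (x - y) = z · x - z · y.
Proof. by rewrite cmulDr cmulNr. Qed.

Lemma cstarN x : cstar (- x) = - cstar x.
Proof. by rewrite -scaleN1r cstarZ rmorphN1 scaleN1r. Qed.

Lemma cstarB x y : cstar (x - y) = cstar x - cstar y.
Proof. by rewrite cstarD cstarN. Qed.

Lemma cstarZr a x : cstar (a%:C *: x) = a%:C *: cstar x.
Proof. by rewrite cstarZ conj_Creal// complex_real. Qed.

Lemma cstarZi a x : cstar ((a *i) *: x) = - ((a *i) *: cstar x).
Proof. by rewrite cstarZ conj_im scaleNr. Qed.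

Lemma rnormM x y : rnorm (x · y) <= rnorm x * rnorm y.
Proof. by rewrite -lecR rmorphM/= -!normE cnormM. Qed.

Lemma rnorm_starM x : rnorm (cstar x · x) = rnorm x ^+ 2.
Proof. by apply: complexI; rewrite rmorphXn/= -!normE cnorm_star. Qed.

(** [|y|^2 = |y^* y| <= |y^*| |y|], applied to [y = x] and [y = x^*]. *)
Lemma rnorm_cstar x : rnorm (cstar x) = rnorm x.
Proof.
suff le y : rnorm y <= rnorm (cstar y).
  by apply/le_anti; rewrite le andbT -{2}[x]cstarK le.
have [->|y0] := eqVneq (rnorm y) 0; first exact: rnorm_ge0.
have {}y0 : 0 < rnorm y by rewrite lt_neqAle eq_sym y0 rnorm_ge0.
by rewrite -(ler_pM2r y0) -expr2 -rnorm_starM rnormM.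
Qed.

Lemma rnorm_Mstar x : rnorm (x · cstar x) = rnorm x ^+ 2.
Proof. by rewrite -{1}[x]cstarK rnorm_starM rnorm_cstar. Qed.

Lemma rnorm_sqr x : cstar x = x -> rnorm (x · x) = rnorm x ^+ 2.
Proof. by move=> {1}<-; exact: rnorm_starM. Qed.

Lemma rnorm_mul_contr e : (forall y, rnorm (y + e · y) <= rnorm y) ->
  forall z, rnorm (e · z) <= 2 * rnorm z.
Proof.
move=> contr z; rewrite -[e · z](addrK z) [e · z + z]addrC.
by rewrite (le_trans (rnormB _ _))// mulr_natl mulr2n lerD2r.
Qed.

Section Resolvent.
Context (k : A) (k_sa : cstar k = k).

(** In the C*-identity for [a x + i b k x] the two cross terms cancel since [k]
    is self-adjoint. *)
Lemma rnorm_rotation a b x :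
  rnorm (a%:C *: x + (b *i) *: (k · x)) ^+ 2 <=
  (a ^+ 2 + b ^+ 2 * rnorm k ^+ 2) * rnorm x ^+ 2.
Proof.
rewrite -rnorm_starM cstarD cstarZr cstarZi cstarM k_sa.
have -> : (a%:C *: cstar x - b*i *: (cstar x · k)) · (a%:C *: x + b*i *: (k · x))
   = (a ^+ 2)%:C *: (cstar x · x) + (b ^+ 2)%:C *: (cstar x · k · (k · x)).
  rewrite cmulDr !cmulBl !(cmulZl, cmulZr) !scalerA !cmulA.
  rewrite mulc_re_im mulc_im_re mulc_im_im [b * a]mulrC -rmorphM/= -!expr2.
  by rewrite addrA subrK scaleNr opprK.
rewrite mulrDl (le_trans (rnormD _ _))// !rnormZr ?sqr_ge0// lerD//.
  by rewrite rnorm_starM.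
rewrite -mulrA ler_wpM2l ?sqr_ge0// (le_trans (rnormM _ _))//.
rewrite -exprMn expr2 ler_pM ?rnorm_ge0 ?rnormM//.
by rewrite (le_trans (rnormM _ _))// rnorm_cstar mulrC.
Qed.

(** Write [x] as [c y + ((1 - c) x + i c s k x)] with [y = x - i s k x].  The
    second summand has norm at most [(1 - c + O(c^2)) |x|]; subtract, divide by
    [c] and let [c] tend to 0. *)
Lemma dissipative_le s x : rnorm x <= rnorm (x - (s *i) *: (k · x)).
Proof.
set y := x - _; set M := s ^+ 2 * rnorm k ^+ 2.
have M0 : 0 <= M by rewrite mulr_ge0 ?sqr_ge0.
suff h (c : R) : 0 < c -> c <= 1/2 -> rnorm x <= rnorm y + c * (M * rnorm x).
  apply/ler_addgt0Pr => e e0.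
  have B0 : 0 < 1 + M * rnorm x by rewrite ltr_wpDr// mulr_ge0// rnorm_ge0.
  set B := 1 + _ in B0.
  pose c := Num.min (1/2) (e / B).
  have c0 : 0 < c by rewrite /c lt_min; apply/andP; split; [lra|exact: divr_gt0].
  rewrite (le_trans (h c c0 _)) ?/c ?ge_min ?lexx// lerD2l.
  rewrite (@le_trans _ _ (e / B * B))//; last by rewrite divfK// gt_eqF.
  rewrite ler_pM ?(ltW c0)//; [by rewrite mulr_ge0// rnorm_ge0| |].
    by rewrite ge_min lexx orbT.
  by rewrite /B lerDr.
move=> c0 c12.
have xE : x = c%:C *: y + ((1 - c)%:C *: x + ((c * s) *i) *: (k · x)).
  rewrite /y scalerBr scalerA mulc_re_im.
  rewrite addrACA addrA -addrA addNr addr0 -scalerDl.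
  rewrite [X in X *: x](_ : _ = 1) ?scale1r//.
  by rewrite -rmorphD/= addrC subrK.
have rot : rnorm ((1 - c)%:C *: x + ((c * s) *i) *: (k · x)) <=
    (1 - c + c ^+ 2 * M) * rnorm x.
  have q0 : 0 <= 1 - c + c ^+ 2 * M.
    by apply: addr_ge0; [lra | apply: mulr_ge0 => //; exact: sqr_ge0].
  apply: le_of_sqr; first by rewrite mulr_ge0// rnorm_ge0.
  rewrite (le_trans (rnorm_rotation _ _ _))// [leRHS]exprMn.
  rewrite ler_wpM2r ?sqr_ge0// exprMn -mulrA -/M.
  have : 0 <= c ^+ 2 * M by apply: mulr_ge0 => //; exact: sqr_ge0.
  set t := c ^+ 2 * M => t0.
  have ct0 : 0 <= (1/2 - c) * t by apply: mulr_ge0 => //; rewrite subr_ge0.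
  have tt0 : 0 <= t * t by rewrite mulr_ge0.
  rewrite !expr2; lra.
have : rnorm x <= c * rnorm y + (1 - c + c ^+ 2 * M) * rnorm x.
  by rewrite {1}xE (le_trans (rnormD _ _))// lerD// rnormZr// ltW.
move=> h; rewrite -(ler_pM2l c0); nra.
Qed.

Lemma resolvent_inj s x y :
  x - (s *i) *: (k · x) = y - (s *i) *: (k · y) -> x = y.
Proof.
move=> xy; apply/eqP; rewrite -subr_eq0; apply/eqP/rnorm_eq0/le_anti.
rewrite rnorm_ge0 andbT (le_trans (dissipative_le s _))//.
by rewrite cmulBr scalerBr subrACA xy subrr rnorm0.
Qed.

(** The map [x |-> (1 - c) x + c (y + i s k x)] has Lipschitz constant
    [sqrt ((1 - c)^2 + c^2 s^2 |k|^2)], which is less than 1 for small [c]. *)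
Lemma resolvent_exists s y : exists x, x - (s *i) *: (k · x) = y.
Proof.
set M := s ^+ 2 * rnorm k ^+ 2.
have M0 : 0 <= M by apply: mulr_ge0; exact: sqr_ge0.
have M1 : 0 < 1 + M by rewrite ltr_wpDr.
pose c := (1 + M)^-1.
have c0 : 0 < c by rewrite invr_gt0.
have c1 : c <= 1 by rewrite invf_le1// lerDl.
have cE : (1 - c) ^+ 2 + c ^+ 2 * M = 1 - c.
  by rewrite /c; field; rewrite gt_eqF.
have q0 : 0 <= 1 - c by rewrite subr_ge0.
pose f x := (1 - c)%:C *: x + c%:C *: (y + (s *i) *: (k · x)).
have [||x1 x2|x fx] := @contraction_fixpoint _ A f (Num.sqrt (1 - c)).
- exact: sqrtr_ge0.
- by rewrite -[ltRHS]sqrtr1 ltr_sqrt// gtrBl.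
- have -> : f x1 - f x2 =
      (1 - c)%:C *: (x1 - x2) + ((c * s) *i) *: (k · (x1 - x2)).
    rewrite /f !(scalerBr, scalerDr, cmulBr) !scalerA mulc_re_im.
    by rewrite opprD addrACA opprD [X in _ + X]addrACA subrr add0r.
  apply: le_of_sqr; first by rewrite mulr_ge0 ?sqrtr_ge0 ?rnorm_ge0.
  rewrite (le_trans (rnorm_rotation _ _ _))// [leRHS]exprMn sqr_sqrtr//.
  by rewrite ler_wpM2r ?sqr_ge0// exprMn -mulrA -/M cE.
exists x; have cC0 : c%:C != 0 :> R[i] by rewrite eq_complex/= gt_eqF.
apply: (scalerI cC0); rewrite scalerBr; apply/eqP.
rewrite subr_eq -scalerDr; apply/eqP.
move: fx; rewrite /f rmorphB/= scalerBl scale1r => fx.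
by apply: (addrI (x - c%:C *: x)); rewrite fx subrK.
Qed.

End Resolvent.

(** Here [1 + e] is [(1 - i s k)^-1] with [k = d d^*].  It is a contraction by
    [dissipative_le].  From [i s k (1 + e) = e] one gets [s |k + e k| <= 2], and
    [|d + e d|^2 <= |k + e k|], so [s] has only to be large. *)
Lemma approximate_unit_at d (eps : R) : 0 < eps -> exists e,
  [/\ forall I : set A, closed_ideal I -> I (d · cstar d) -> I e,
      forall y, rnorm (y + e · y) <= rnorm y
    & rnorm (d + e · d) < eps].
Proof.
move=> eps0; set k := d · cstar d.
have k_sa : cstar k = k by rewrite /k cstarM cstarK.
(* This choice turns the bound [sqrt (2 / s)] below into [eps / 2]. *)
pose s : R := 2 / (eps / 2) ^+ 2.
have s0 : 0 < s by rewrite divr_gt0// exprn_gt0// divr_gt0.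
have [e eP] := resolvent_exists k_sa s ((s *i) *: k).
have eE : e = (s *i) *: k + (s *i) *: (k · e) by rewrite -eP subrK.
have contr y : rnorm (y + e · y) <= rnorm y.
  have ey : e · y = (s *i) *: (k · (y + e · y)).
    by rewrite {1}eE cmulDl !cmulZl -cmulA -scalerDr -cmulDr.
  have {3}-> : y = (y + e · y) - (s *i) *: (k · (y + e · y)).
    by rewrite -ey addrK.
  exact: dissipative_le.
exists e; split=> //.
  move=> I I_id Ik; rewrite eE; apply: (idealD I_id); apply: (idealZ I_id) => //.
  exact: (idealMr I_id).
(* Both sides solve [x - i s k x = i s k k]. *)
have ek : e · k = k · e.
  apply: (resolvent_inj k_sa (s := s)).
  have -> : k · e - s*i *: (k · (k · e)) = (s *i) *: (k · k).
    by rewrite -cmulZr -cmulBr eP cmulZr.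
  by rewrite -[in RHS]cmulZl -eP cmulBl cmulZl cmulA.
have kk z : s * rnorm ((k + e · k) · z) <= 2 * rnorm z.
  rewrite -rnormZi ?(ltW s0)//.
  have -> : s*i *: ((k + e · k) · z) = e · z.
    by rewrite ek {2}eE cmulDl scalerDr -!cmulZl cmulDl.
  exact: rnorm_mul_contr.
have kbound : rnorm (k + e · k) <= 2 / s.
  set w := k + e · k; have [->|w0] := eqVneq w 0.
    by rewrite rnorm0 divr_ge0// ltW.
  have {}w0 : 0 < rnorm w.
    by rewrite lt_neqAle rnorm_ge0 andbT eq_sym; apply: contraNN w0 => /eqP/rnorm_eq0->.
  rewrite ler_pdivlMr// mulrC -(ler_pM2r w0) -mulrA -expr2 -rnorm_Mstar.
  by rewrite (le_trans (kk _))// rnorm_cstar.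
have : rnorm (d + e · d) ^+ 2 <= 2 / s.
  apply: le_trans kbound; rewrite -rnorm_Mstar cmulDl -cmulA.
  rewrite (le_trans (contr _))// -rnorm_cstar cstarM cstarK.
  by rewrite cmulDl -cmulA.
rewrite /s invf_div mulrCA divff ?mulr1// => /le_of_sqr le2.
rewrite (le_lt_trans (le2 _))//; first by rewrite divr_ge0// ltW.
by rewrite ltr_pdivrMr// mulr_natr mulr2n ltrDl.
Qed.

End CStarCalculus.

(** * Closed two-sided ideals *)

Section Ideals.
Context (R : realType) (A : cstarAlgType R).
Implicit Types (I J D : set A) (x y z : A).

Lemma ideal_lim I x : closed_ideal I ->
  (forall e : R, 0 < e -> exists2 y, I y & rnorm (x - y) < e) -> I x.
Proof. by move=> /ideal_closed/closed_rnormP; exact. Qed.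

Lemma idealN I x : closed_ideal I -> I x -> I (- x).
Proof. by move=> I_id Ix; rewrite -scaleN1r; exact: idealZ. Qed.

Lemma idealB I x y : closed_ideal I -> I x -> I y -> I (x - y).
Proof. by move=> I_id Ix Iy; apply: idealD => //; exact: idealN. Qed.

(** [x^*] is approximated by [- e x^*] with [e] in the ideal generated by
    [x^* x], which lies in [I]. *)
Lemma ideal_cstar I x : closed_ideal I -> I x -> I (cstar x).
Proof.
move=> I_id Ix; apply: ideal_lim => // eps eps0.
have [e [eI _ ex]] := approximate_unit_at (cstar x) eps0.
exists (- (e · cstar x)); last by rewrite opprK.
apply: idealN => //; apply: idealMr => //; apply: eI => //.
by rewrite cstarK; exact: idealMl.
Qed.

Lemma closed_idealT : closed_ideal (setT : set A).
Proof. by split=> //; exact: closedT. Qed.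

Lemma closed_idealI I J :
  closed_ideal I -> closed_ideal J -> closed_ideal (I `&` J).
Proof.
move=> I_id J_id; split=> [||x y [Ix Jx] [Iy Jy]|c x [Ix Jx]|a x [Ix Jx]|a x [Ix Jx]].
- by apply: closedI; exact: ideal_closed.
- by split; exact: ideal0.
- by split; exact: idealD.
- by split; exact: idealZ.
- by split; exact: idealMl.
- by split; exact: idealMr.
Qed.

(** The sum [I + D], written so that the component in [I] is the witness. *)
Definition ideal_sum I D : set A := [set x | exists2 i, I i & D (x - i)].

(** The component in [I] of an element of [I + D] can be chosen under control of
    the norm: for [x = a + d] replace [a] by [- e x + (a + e a)], where [e] in [I]
    makes [a + e a] small.  This makes [I + D] closed. *)
Lemma ideal_sum_bounded I D x (eps : R) : closed_ideal I -> closed_ideal D ->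
    ideal_sum I D x -> 0 < eps ->
  exists i, [/\ I i, D (x - i) & rnorm i <= 2 * rnorm x + eps].
Proof.
move=> I_id D_id [a Ia Dxa] eps0.
have [e [eI ec ea]] := approximate_unit_at a eps0.
have Ie : I e by apply: eI => //; exact: idealMr.
exists (a + e · a - e · x); split.
- apply: idealB => //; last exact: idealMr.
  by apply: idealD => //; exact: idealMr.
- rewrite opprB opprD addrA addrACA -cmulBr.
  by apply: idealD => //; exact: idealMl.
- rewrite addrC (le_trans (rnormD _ _))// lerD//; last exact: ltW.
  by rewrite rnormN rnorm_mul_contr.
Qed.

(** A limit of elements of [I + D] is the sum of a rapidly convergent telescoping
    series; by [ideal_sum_bounded] its terms have components in [I] that
    converge geometrically as well. *)
Lemma closed_ideal_sum I D :
  closed_ideal I -> closed_ideal D -> closed_ideal (ideal_sum I D).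
Proof.
move=> I_id D_id.
have sumB x y : ideal_sum I D x -> ideal_sum I D y -> ideal_sum I D (x - y).
  move=> [i Ii Di] [j Ij Dj]; exists (i - j); first exact: idealB.
  by rewrite subrACA; exact: idealB.
split=> [|||c x [i Ii Di]|a x [i Ii Di]|a x [i Ii Di]].
- apply/closed_rnormP => x xlim.
  pose q n : R := 2^-1 ^+ n.
  have q0 n : 0 < q n by rewrite exprn_gt0// invr_gt0.
  have /choice[u uP] n : exists y, ideal_sum I D y /\ rnorm (x - y) < q n.
    by have [y] := xlim _ (q0 n); exists y.
  have /choice[v vP] n : exists i, [/\ I i, D (u n.+1 - u n - i) &
      rnorm i <= 2 * rnorm (u n.+1 - u n) + q n].
    by apply: ideal_sum_bounded => //; apply: sumB; apply: (uP _).1.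
  have [i0 Ii0 Di0] := (uP 0%N).1.
  pose w n := i0 + \sum_(j < n) v j.
  have wI n : I (w n).
    elim: n => [|n ih]; first by rewrite /w big_ord0 addr0.
    rewrite /w big_ord_recr/= addrA; apply: idealD => //.
    by case: (vP n).
  have wD n : D (u n - w n).
    elim: n => [|n ih]; first by rewrite /w big_ord0 addr0.
    rewrite /w big_ord_recr/= addrA -/(w n) opprD addrA.
    rewrite -[u n.+1](subrK (u n)) -addrA -addrA [u n + _]addrA addrCA.
    by apply: idealD => //; case: (vP n).
  have wstep n : rnorm (w n.+1 - w n) <= 7 * 2^-1 ^+ n.
    have -> : w n.+1 - w n = v n by rewrite /w big_ord_recr/= addrA [LHS]addrC addKr.
    rewrite -/(q n).
    case: (vP n) => _ _ /le_trans; apply.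
    have := rdistD x (u n.+1) (u n); rewrite [rnorm (_ - x)]rdistC.
    have [_] := uP n; have [_] := uP n.+1.
    rewrite /q exprS -/(q n) => h1 h2 h3.
    have := q0 n; lra.
  have [||//|w' w'P] := geometric_cvg _ _ _ wstep; [lra|lra|].
  have C14 : 7 / (1 - 2^-1) = 14 :> R by field.
  rewrite C14 in w'P; have small (e : R) : 0 < e -> exists n, 15 * q n < e.
    by move=> e0; apply: geometric_small => //; lra.
  exists w'.
    apply: ideal_lim => // e e0; have [n ne] := small e e0.
    exists (w n) => //; apply: le_lt_trans (w'P n) _; apply: le_lt_trans ne.
    rewrite -/(q n) ler_pM2r//; lra.
  apply: ideal_lim => // e e0; have [n ne] := small e e0.
  exists (u n - w n) => //; rewrite subrACA; apply: le_lt_trans ne.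
  apply: le_trans (rnormB _ _) _.
  have := w'P n; have [_] := uP n; rewrite -/(q n) => h1 h2.
  have -> : 15 * q n = q n + 14 * q n by ring.
  by rewrite lerD// ltW.
- by exists 0; [exact: ideal0 | rewrite subrr; exact: ideal0].
- move=> x y sx sy; rewrite -[y]opprK; apply: (sumB) => //.
  rewrite -[- y]sub0r; apply: sumB => //.
  by exists 0; [exact: ideal0 | rewrite subrr; exact: ideal0].
- by exists (c *: i); [exact: idealZ | rewrite -scalerBr; exact: idealZ].
- by exists (a · i); [exact: idealMl | rewrite -cmulBr; exact: idealMl].
- by exists (i · a); [exact: idealMr | rewrite -cmulBl; exact: idealMr].
Qed.

(** The inclusion of [(I + D) `&` (J + D)] in [(I `&` J) + D].  An element [i] is
    approximated by [- e i] with [e] in [I], and [e i] equals [e j] modulo [D]. *)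
Lemma ideal_sum_cap I J D i j :
    closed_ideal I -> closed_ideal J -> closed_ideal D ->
    I i -> J j -> D (i - j) ->
  exists2 c, (I `&` J) c & D (i - c).
Proof.
move=> I_id J_id D_id Ii Jj Dij.
have IJ_id := closed_idealI I_id J_id.
suff [c cIJ Dc] : ideal_sum (I `&` J) D i by exists c.
apply: ideal_lim; first exact: closed_ideal_sum.
move=> eps eps0; have [e [eI _ ei]] := approximate_unit_at i eps0.
have Ie : I e by apply: eI => //; exact: idealMr.
exists (- (e · i)); last by rewrite opprK.
exists (- (e · j)).
  by apply: (idealN IJ_id); split; [exact: idealMr|exact: idealMl].
by rewrite -opprD -cmulBr; apply: idealN => //; exact: idealMl.
Qed.

End Ideals.

(** * Contractivity of *-homomorphisms *)

Section Contractivity.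
Context (R : realType).

Section Squares.
Context (A : cstarAlgType R).
Implicit Types (g c y z : A).

Lemma scale2 z : 2%:C *: z = z + z.
Proof. by rewrite -[2]/(1 + 1) rmorphD/= scalerDl scale1r. Qed.

(** [2 a = u + u^*] with [u = a + i b], and [u^* u = a^2 + b^2]: a substitute
    for the monotonicity of the norm on positive elements. *)
Lemma rnorm_commuting_sum (a b : A) : cstar a = a -> cstar b = b ->
  a · b = b · a -> rnorm a ^+ 2 <= rnorm (a · a + b · b).
Proof.
move=> a_sa b_sa ab; pose u := a + (1 *i) *: b.
have uE : cstar u = a - (1 *i) *: b by rewrite /u cstarD cstarZi a_sa b_sa.
have -> : a · a + b · b = cstar u · u.
  rewrite uE /u cmulDr !cmulBl !(cmulZl, cmulZr) scalerA mulc_im_im mulr1.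
  by rewrite ab addrA subrK scaleNr scale1r opprK.
rewrite rnorm_starM ler_pXn2r ?nnegrE ?rnorm_ge0//.
have : rnorm (u + cstar u) <= 2 * rnorm u.
  by rewrite (le_trans (rnormD _ _))// rnorm_cstar mulr_natl mulr2n.
have -> : u + cstar u = 2%:C *: a.
  by rewrite uE /u addrACA subrr addr0 scale2.
by rewrite rnormZr// ler_pM2l.
Qed.

(** [((1 + g^2) z)^2 = (2 g z)^2 + ((1 - g^2) z)^2], a sum of two commuting squares. *)
Lemma rnorm_one_plus_square g z : cstar g = g -> cstar z = z ->
  g · z = z · g -> 2 * rnorm (g · z) <= rnorm (z + g · g · z).
Proof.
move=> g_sa z_sa gz.
have ggz : g · g · z = z · (g · g) by rewrite -cmulA gz cmulA gz -cmulA.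
have gz_sa : cstar (g · z) = g · z by rewrite cstarM g_sa z_sa gz.
have ggz_sa : cstar (g · g · z) = g · g · z.
  by rewrite !cstarM g_sa z_sa -ggz.
set x := z + _; set p := g · z; set w := g · g · z.
have zw : z · w = w · z. by rewrite /w cmulA -ggz.
have pp : p · p = w · z by rewrite /p /w cmulA -[g · z · g]cmulA -gz !cmulA.
have x_sa : cstar x = x by rewrite /x cstarD z_sa ggz_sa.
have pz : p · z = z · p by rewrite /p cmulA -gz.
have pw : p · w = w · p.
  have gw : g · w = w · g.
    by rewrite /w -[g · g · z · g]cmulA -gz !cmulA.
  by rewrite /p -[g · z · w]cmulA zw cmulA gw -cmulA.
apply: le_of_sqr; first exact: rnorm_ge0.
rewrite -(rnorm_sqr x_sa).
have -> : x · x = (2%:C *: p) · (2%:C *: p) + (z - w) · (z - w).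
  rewrite !(cmulZl, cmulZr) !scale2 pp /x -/w.
  rewrite !(cmulDl, cmulDr, cmulNl, cmulNr) zw opprB.
  set a := z · z; set b := w · z; set c := w · w.
  rewrite [RHS]addrACA ![b + b + (_ - b)]addrACA subrr !addr0.
  by rewrite [a + b]addrC.
have {1}-> : 2 * rnorm p = rnorm (2%:C *: p) by rewrite rnormZr.
apply: rnorm_commuting_sum.
- by rewrite cstarZr gz_sa.
- by rewrite cstarB z_sa ggz_sa.
- by rewrite cmulZl cmulZr cmulBl cmulBr pz pw.
Qed.

(** [(1 + g^2) (1 + g^4) ... (1 + g^(2^m)) c], in an algebra without unit. *)
Fixpoint square_prod (m : nat) (g c : A) : A :=
  if m is m'.+1 then
    square_prod m' (g · g) c + g · g · square_prod m' (g · g) c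
  else c.

(** [g^(2^m - 1) c]; for [c = g] this is an iterated square. *)
Fixpoint square_pow (m : nat) (g c : A) : A :=
  if m is m'.+1 then square_pow m' (g · g) (g · c) else c.

Lemma square_prodMl m g c y : y · g = g · y ->
  y · square_prod m g c = square_prod m g (y · c).
Proof.
elim: m g => //= m ih g yg.
have ygg : y · (g · g) = g · g · y by rewrite cmulA yg -cmulA yg cmulA.
by rewrite cmulDr cmulA ygg -cmulA !ih.
Qed.

Lemma square_prodMr m g c y :
  square_prod m g c · y = square_prod m g (c · y).
Proof. by elim: m g => //= m ih g; rewrite cmulDl -cmulA !ih. Qed.

Lemma square_prod_sa m g c : cstar g = g -> cstar c = c -> g · c = c · g ->
  cstar (square_prod m g c) = square_prod m g c.
Proof.
elim: m g => //= m ih g g_sa c_sa gc.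
have gg_sa : cstar (g · g) = g · g by rewrite cstarM g_sa.
have ggc : g · g · c = c · (g · g) by rewrite -cmulA gc cmulA gc -cmulA.
rewrite cstarD !cstarM g_sa !ih//; congr (_ + _).
by rewrite square_prodMr square_prodMl// ggc.
Qed.

(** Each factor [1 + g^2] contributes a factor 2 and a power of [g] by
    [rnorm_one_plus_square]. *)
Lemma square_prod_ge m g c : cstar g = g -> cstar c = c -> g · c = c · g ->
  2 ^+ m * rnorm (square_pow m g c) <= rnorm (square_prod m g c).
Proof.
elim: m g c => [|m ih] g c g_sa c_sa gc /=; first by rewrite expr0 mul1r.
have gg_sa : cstar (g · g) = g · g by rewrite cstarM g_sa.
have ggc : g · g · c = c · (g · g) by rewrite -cmulA gc cmulA gc -cmulA.
set z := square_prod m (g · g) c.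
have gz : g · z = square_prod m (g · g) (g · c) by rewrite square_prodMl// cmulA.
rewrite -/z (le_trans _ (rnorm_one_plus_square _ _ _))//; last 2 first.
- exact: square_prod_sa.
- by rewrite gz square_prodMr gc.
rewrite exprS -mulrA ler_pM2l// gz; apply: ih => //.
- by rewrite cstarM g_sa c_sa gc.
- by rewrite -!cmulA; congr (_ · _); rewrite cmulA ggc.
Qed.

(** Multiplying the product by [1 - g^2] telescopes to [c - g^(2^(m+1)) c]. *)
Lemma square_prod_defect m g c : rnorm g <= 1 ->
  rnorm (square_prod m g c - g · g · square_prod m g c) <= 2 * rnorm c.
Proof.
have sq (h : A) : rnorm h <= 1 -> rnorm (h · h) <= 1.
  move=> h1; rewrite (le_trans (rnormM _ _))//.
  by rewrite mulr_ile1 ?rnorm_ge0.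
elim: m g => [|m ih] g g1 /=.
  rewrite (le_trans (rnormB _ _))// mulr_natl mulr2n lerD2l.
  by rewrite (le_trans (rnormM _ _))// ler_piMl ?rnorm_ge0 ?sq.
by rewrite cmulDr cmulA addrKA; apply: ih; exact: sq.
Qed.

Lemma square_pow_norm1 m g : cstar g = g -> rnorm g = 1 ->
  rnorm (square_pow m g g) = 1.
Proof.
elim: m g => //= m ih g g_sa g1; apply: ih; first by rewrite cstarM g_sa.
by rewrite rnorm_sqr// g1 expr1n.
Qed.

End Squares.

(** The equation says that [1 - q] is a left inverse of [1 - k^2].  A
    *-homomorphism preserves it. *)
Lemma quasi_inverse_square (A : cstarAlgType R) (k : A) : rnorm k < 1 ->
  exists q, q = q · (k · k) - k · k.
Proof.
move=> k1.
have [||x y|q qE] := @contraction_fixpoint _ A (fun q => q · (k · k) - k · k)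
  (rnorm k ^+ 2).
- exact: sqr_ge0.
- by rewrite exprn_ilt1// rnorm_ge0.
- rewrite subrACA subrr subr0 -cmulBl (le_trans (rnormM _ _))// mulrC.
  by rewrite ler_wpM2r ?rnorm_ge0// rnormM.
- by exists q.
Qed.

Section StarHom.
Context (A B : cstarAlgType R) (I : set A) (f : A -> B).
Hypotheses (I_id : closed_ideal I) (f_hom : star_hom_on I f).

Lemma star_hom0 : f 0 = 0.
Proof.
have := star_homZ f_hom 0 (ideal0 I_id).
by rewrite scale0r => ->; rewrite scale0r.
Qed.

Lemma star_homN x : I x -> f (- x) = - f x.
Proof. by move=> Ix; rewrite -scaleN1r (star_homZ f_hom)// scaleN1r. Qed.

Lemma star_homB x y : I x -> I y -> f (x - y) = f x - f y.
Proof.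
move=> Ix Iy; rewrite (star_homD f_hom)//; last exact: idealN.
by rewrite star_homN.
Qed.

(** If [|f k| > |k|], rescale so that [h = f k] has norm 1 and [|k| < 1].  Then
    [1 - k^2], hence [1 - h^2], has a left inverse, so [1 - h^2] is bounded
    below.  But it maps elements of norm at least [2 ^ m] to elements of norm at
    most 2. *)
Lemma star_hom_sa_contr k : I k -> cstar k = k -> rnorm (f k) <= rnorm k.
Proof.
move=> Ik k_sa; rewrite leNgt; apply/negP => lt_kh.
have h0 : 0 < rnorm (f k) by exact: le_lt_trans (rnorm_ge0 _) lt_kh.
pose t := (rnorm (f k))^-1.
have t0 : 0 <= t by rewrite invr_ge0 ltW.
pose k1 := t%:C *: k; pose h1 := f k1.
have Ik1 : I k1 by exact: idealZ.
have k1_lt : rnorm k1 < 1 by rewrite rnormZr// ltr_pdivrMl// mulr1.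
have h1E : h1 = t%:C *: f k by rewrite /h1 (star_homZ f_hom).
have h1_1 : rnorm h1 = 1 by rewrite h1E rnormZr// mulVf// gt_eqF.
have h1_sa : cstar h1 = h1.
  by rewrite h1E cstarZr -(star_homS f_hom)// k_sa.
have [q qE] := quasi_inverse_square k1_lt.
have Ikk : I (k1 · k1) by exact: idealMl.
have Iq : I q by rewrite qE; apply: idealB => //; exact: idealMl.
have fqE : f q = f q · (h1 · h1) - h1 · h1.
  rewrite {1}qE star_homB//; last exact: idealMl.
  by rewrite !(star_homM f_hom)//.
have bound z : rnorm z <= (1 + rnorm (f q)) * rnorm (z - h1 · h1 · z).
  have {1}-> : z = (z - h1 · h1 · z) - f q · (z - h1 · h1 · z).
    have fqhh : f q - f q · (h1 · h1) = - (h1 · h1).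
      by rewrite {1}fqE addrAC subrr sub0r.
    by rewrite cmulBr cmulA -cmulBl fqhh cmulNl opprK subrK.
  rewrite (le_trans (rnormB _ _))// mulrDl mul1r lerD2l; exact: rnormM.
have C0 : 0 < 2 * (1 + rnorm (f q)).
  by rewrite mulr_gt0// ltr_pwDl// rnorm_ge0.
have h12 : rnorm h1 <= 1 by rewrite h1_1.
have half0 : 0 <= 2^-1 :> R by [].
have half1 : 2^-1 < 1 :> R by rewrite invf_lt1// ltr1n.
(* Choose [m] with [2 (1 + |f q|) < 2 ^ m]. *)
have [m mlt] := geometric_small half0 half1 (ltW C0) ltr01.
have := square_prod_ge m h1_sa h1_sa erefl; rewrite square_pow_norm1// mulr1.
move=> /le_trans/(_ (bound _)) le1.
have := square_prod_defect m h1 h12; rewrite h1_1 mulr1 => le2.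
have : 2 ^+ m <= 2 * (1 + rnorm (f q)).
  rewrite (le_trans le1)// mulrC ler_wpM2r//.
  by rewrite addr_ge0// rnorm_ge0.
by rewrite leNgt -[ltRHS]mul1r -ltr_pdivrMr ?exprn_gt0// -exprVn mlt.
Qed.

Lemma star_hom_contr x : I x -> rnorm (f x) <= rnorm x.
Proof.
move=> Ix; have Isx := ideal_cstar I_id Ix.
apply: le_of_sqr; first exact: rnorm_ge0.
rewrite -!rnorm_starM -(star_homS f_hom)// -(star_homM f_hom)//.
apply: star_hom_sa_contr; first exact: idealMl.
by rewrite cstarM cstarK.
Qed.

End StarHom.
End Contractivity.

(** * A closed ideal as a C*-algebra *)

(** Ideals bundled with their properties, so that the structures on the
    corresponding algebras can be inferred. *)
Record cideal (R : realType) (A : cstarAlgType R) := CIdeal {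
  cideal_set :> set A ;
  cidealP : closed_ideal cideal_set }.

Section CidealPredicate.
Context (R : realType) (A : cstarAlgType R) (D : cideal A).

Definition cideal_pred : {pred A} := [pred x | `[< cideal_set D x >]].

Lemma cideal_pred_submod : subsemimod_closed cideal_pred.
Proof.
have D_id := cidealP D; split=> [|c x /asboolP Dx]; last first.
  by apply/asboolP; exact: idealZ.
split=> [|x y /asboolP Dx /asboolP Dy]; apply/asboolP; first exact: ideal0.
exact: idealD.
Qed.

HB.instance Definition _ :=
  GRing.isSubmodClosed.Build R[i] A cideal_pred cideal_pred_submod.

End CidealPredicate.

Section IdealAlgebra.
Context (R : realType) (A : cstarAlgType R) (D : cideal A).

Record ideal_alg := IdealElt {
  ideal_val : A ;
  ideal_valP : ideal_val \in cideal_pred D }.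

HB.instance Definition _ := [isSub for ideal_val].
HB.instance Definition _ := [Choice of ideal_alg by <:].
HB.instance Definition _ := [SubChoice_isSubLmodule of ideal_alg by <:].

Lemma ideal_valD : {morph ideal_val : x y / x + y}.
Proof. exact: (raddfD (val : ideal_alg -> A)). Qed.

Lemma ideal_valZ (c : R[i]) : {morph ideal_val : x / c *: x}.
Proof. by []. Qed.

Lemma ideal_val_inj : injective ideal_val.
Proof. exact: val_inj. Qed.

Lemma ideal_val_mem (x : ideal_alg) : cideal_set D (ideal_val x).
Proof. by have /asboolP := ideal_valP x. Qed.

Definition ideal_elt x (Dx : cideal_set D x) : ideal_alg := IdealElt (asboolT Dx).

Definition ideal_norm (x : ideal_alg) : R[i] := `|ideal_val x|.

Lemma ideal_normD x y : ideal_norm (x + y) <= ideal_norm x + ideal_norm y.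
Proof. by rewrite /ideal_norm ideal_valD ler_normD. Qed.

Lemma ideal_normZ (c : R[i]) x : ideal_norm (c *: x) = `|c| * ideal_norm x.
Proof. by rewrite /ideal_norm ideal_valZ normrZ. Qed.

Lemma ideal_norm0_eq0 x : ideal_norm x = 0 -> x = 0.
Proof. by move/normr0_eq0 => x0; apply: ideal_val_inj; rewrite x0. Qed.

HB.instance Definition _ := Lmodule_isNormed.Build R[i] ideal_alg
  ideal_normD ideal_normZ ideal_norm0_eq0.

Lemma ideal_alg_complete (F : set_system ideal_alg) :
  ProperFilter F -> cauchy F -> cvg F.
Proof.
apply: (@complete_of_geometric _ _ 4) => // u ustep.
have half0 : 0 <= 2^-1 :> R by [].
have half1 : 2^-1 < 1 :> R by rewrite invf_lt1// ltr1n.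
have [|l lP] := geometric_cvg (u := ideal_val \o u) half0 half1 (ler0n R 2).
  by move=> n; exact: ustep.
have C4 : 2 / (1 - 2^-1) = 4 :> R by field.
rewrite C4 in lP.
have Dl : cideal_set D l.
  apply: (ideal_lim (cidealP D)) => e e0.
  have [n ne] := geometric_small half0 half1 (ler0n R 4) e0.
  exists (ideal_val (u n)); first exact: ideal_val_mem.
  exact: le_lt_trans (lP n) ne.
by exists (ideal_elt Dl).
Qed.

HB.instance Definition _ := Uniform_isComplete.Build ideal_alg ideal_alg_complete.

Definition ideal_cmul (x y : ideal_alg) : ideal_alg :=
  ideal_elt (idealMl (cidealP D) (ideal_val x) (ideal_val_mem y)).

Definition ideal_star (x : ideal_alg) : ideal_alg :=
  ideal_elt (ideal_cstar (cidealP D) (ideal_val_mem x)).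

Definition ideal_alg_CStar : CompleteNormedModule_isCStarAlgebra R ideal_alg.
Proof.
apply: (@CompleteNormedModule_isCStarAlgebra.Build R ideal_alg
  ideal_cmul ideal_star).
- by move=> x y z; apply: ideal_val_inj; exact: cmulA.
- by move=> x y z; apply: ideal_val_inj; exact: cmulDl.
- by move=> x y z; apply: ideal_val_inj; exact: cmulDr.
- by move=> c x y; apply: ideal_val_inj; exact: cmulZl.
- by move=> c x y; apply: ideal_val_inj; exact: cmulZr.
- by move=> x y; apply: ideal_val_inj; exact: cstarD.
- by move=> c x; apply: ideal_val_inj; exact: cstarZ.
- by move=> x y; apply: ideal_val_inj; exact: cstarM.
- by move=> x; apply: ideal_val_inj; exact: cstarK.
- by move=> x y; exact: (cnormM (ideal_val x) (ideal_val y)).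
- by move=> x; exact: (cnorm_star (ideal_val x)).
Defined.

HB.instance Definition _ := ideal_alg_CStar.

Lemma ideal_val_star_hom : star_hom ideal_val.
Proof. by split=> // x y _ _; rewrite ideal_valD. Qed.

End IdealAlgebra.

(** * The quotient C*-algebra *)

Section QuotientAlgebra.
Context (R : realType) (A : cstarAlgType R) (D : cideal A).

Definition quot_alg := Quotient.quot (cideal_pred D).

HB.instance Definition _ := GRing.Zmodule.on quot_alg.

Definition quot_proj (x : A) : quot_alg :=
  (\pi_(Quotient.quot (cideal_pred D)) x)%qT.
Definition quot_lift (u : quot_alg) : A :=
  generic_quotient.repr (u : Quotient.quot (cideal_pred D)).

Lemma quot_liftK : cancel quot_lift quot_proj.
Proof. exact: generic_quotient.reprK. Qed.

Lemma quot_projD : {morph quot_proj : x y / x + y}.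
Proof. by move=> x y; rewrite /quot_proj !piE. Qed.

Lemma quot_projN : {morph quot_proj : x / - x}.
Proof. by move=> x; rewrite /quot_proj !piE. Qed.

Lemma quot_projB : {morph quot_proj : x y / x - y}.
Proof. by move=> x y; rewrite quot_projD quot_projN. Qed.

Lemma quot_proj_eq x y : quot_proj x = quot_proj y <-> cideal_set D (x - y).
Proof.
split=> [/eqP|Dxy].
  by rewrite -Quotient.idealrBE => /asboolP.
by apply/eqP; rewrite -Quotient.idealrBE; apply/asboolP.
Qed.

Lemma quot_proj0 : quot_proj 0 = 0.
Proof. by rewrite /quot_proj !piE. Qed.

Lemma quot_proj_eq0 x : quot_proj x = 0 <-> cideal_set D x.
Proof. by rewrite -quot_proj0 quot_proj_eq subr0. Qed.

Lemma quot_liftP x : cideal_set D (quot_lift (quot_proj x) - x).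
Proof. by apply/quot_proj_eq; rewrite quot_liftK. Qed.

Definition quot_scale (c : R[i]) (u : quot_alg) := quot_proj (c *: quot_lift u).

Lemma quot_projZ0 c x : quot_proj (c *: x) = quot_scale c (quot_proj x).
Proof.
apply/esym/quot_proj_eq; rewrite -scalerBr; apply: (idealZ (cidealP D)).
exact: quot_liftP.
Qed.

Lemma quot_ind (P : quot_alg -> Prop) :
  (forall x, P (quot_proj x)) -> forall u, P u.
Proof. by move=> h u; rewrite -[u]quot_liftK. Qed.

Lemma quot_scaleA a b u : quot_scale a (quot_scale b u) = quot_scale (a * b) u.
Proof. by elim/quot_ind: u => x; rewrite -!quot_projZ0 scalerA. Qed.

Lemma quot_scale1 : left_id 1 quot_scale.
Proof. by elim/quot_ind=> x; rewrite -!quot_projZ0 scale1r. Qed.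

Lemma quot_scaleDr : right_distributive quot_scale +%R.
Proof.
move=> c; elim/quot_ind=> x; elim/quot_ind=> y.
by rewrite -quot_projD -!quot_projZ0 scalerDr quot_projD.
Qed.

Lemma quot_scaleDl u : {morph quot_scale^~ u : a b / a + b}.
Proof.
by elim/quot_ind: u => x a b; rewrite -!quot_projZ0 scalerDl quot_projD.
Qed.

HB.instance Definition _ := GRing.Zmodule_isLmodule.Build R[i] quot_alg
  quot_scaleA quot_scale1 quot_scaleDr quot_scaleDl.

Lemma quot_projZ c x : quot_proj (c *: x) = c *: quot_proj x.
Proof. exact: quot_projZ0. Qed.

(** The distance of a representative to [D]. *)
Definition quot_rnorm (u : quot_alg) : R :=
  inf [set r | exists2 x, quot_proj x = u & rnorm x = r].

Lemma quot_rnorm_has_inf u :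
  has_inf [set r | exists2 x, quot_proj x = u & rnorm x = r].
Proof.
split; first by exists (rnorm (quot_lift u)), (quot_lift u) => //; exact: quot_liftK.
by exists 0 => _ [x _ <-]; exact: rnorm_ge0.
Qed.

Lemma quot_rnorm_le x : quot_rnorm (quot_proj x) <= rnorm x.
Proof.
by apply: ge_inf; [exact: (quot_rnorm_has_inf _).2 | exists x].
Qed.

Lemma quot_rnorm_lift u (e : R) : 0 < e ->
  exists2 x, quot_proj x = u & rnorm x < quot_rnorm u + e.
Proof.
move=> e0; have [_ [x xu <-] lt_x] := inf_adherent e0 (quot_rnorm_has_inf u).
by exists x.
Qed.

Lemma quot_rnorm_ge0 u : 0 <= quot_rnorm u.
Proof.
by apply: lb_le_inf => [|_ [x _ <-]]; [exact: (quot_rnorm_has_inf u).1|exact: rnorm_ge0].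
Qed.

Lemma quot_rnormD u v : quot_rnorm (u + v) <= quot_rnorm u + quot_rnorm v.
Proof.
apply/ler_addgt0Pr => e e0; have e20 : 0 < e / 2 by rewrite divr_gt0.
have [x <- xu] := quot_rnorm_lift u e20; have [y <- yv] := quot_rnorm_lift v e20.
rewrite -quot_projD (le_trans (quot_rnorm_le _))// (le_trans (rnormD _ _))//.
by rewrite [e]splitr addrACA lerD// ltW.
Qed.

Lemma quot_rnormZ_le (c : R[i]) u :
  quot_rnorm (c *: u) <= complex.Re `|c| * quot_rnorm u.
Proof.
have c0 : 0 <= complex.Re `|c| by rewrite normc_def/= sqrtr_ge0.
apply/ler_addgt0Pr => e e0.
have c1 : 0 < complex.Re `|c| + 1 by rewrite ltr_wpDl.
have [x xu lx] := quot_rnorm_lift u (divr_gt0 e0 c1).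
rewrite -{1}xu -quot_projZ (le_trans (quot_rnorm_le _))// rnormZ.
rewrite (le_trans (ler_wpM2l c0 (ltW lx)))// mulrDr lerD2l.
by rewrite mulrC mulrAC ler_pdivrMr// ler_wpM2l ?ltW// ltrDl.
Qed.

Lemma quot_rnormZ (c : R[i]) u :
  quot_rnorm (c *: u) = complex.Re `|c| * quot_rnorm u.
Proof.
apply/le_anti/andP; split; first exact: quot_rnormZ_le.
have [->|cn0] := eqVneq c 0; first by rewrite normr0 mul0r quot_rnorm_ge0.
have cE (d : R[i]) : (complex.Re `|d|)%:C = `|d| by rewrite RRe_real// normr_real.
have c0 : 0 < complex.Re `|c| by rewrite -ltcR cE normr_gt0.
rewrite -[in leLHS](scale1r u) -(mulVf cn0) -scalerA.
rewrite -ler_pdivlMl// (le_trans (quot_rnormZ_le _ _))//.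
rewrite ler_wpM2r ?quot_rnorm_ge0// -lecR fmorphV/= !cE normfV//.
Qed.

Lemma quot_rnorm_eq0 u : quot_rnorm u = 0 -> u = 0.
Proof.
elim/quot_ind: u => x x0; apply/quot_proj_eq0.
apply: (ideal_lim (cidealP D)) => e e0.
have [y yx] := quot_rnorm_lift (quot_proj x) e0.
rewrite x0 add0r => ye; exists (x - y); last by rewrite opprB addrC subrK.
exact/quot_proj_eq.
Qed.

Definition quot_norm (u : quot_alg) : R[i] := (quot_rnorm u)%:C.

Lemma quot_normD u v : quot_norm (u + v) <= quot_norm u + quot_norm v.
Proof. by rewrite /quot_norm -rmorphD/= lecR quot_rnormD. Qed.

Lemma quot_normZ c u : quot_norm (c *: u) = `|c| * quot_norm u.
Proof.
by rewrite /quot_norm quot_rnormZ rmorphM; congr (_ * _).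
Qed.

Lemma quot_norm_eq0 u : quot_norm u = 0 -> u = 0.
Proof. by move/complexI/quot_rnorm_eq0. Qed.

HB.instance Definition _ := Lmodule_isNormed.Build R[i] quot_alg
  quot_normD quot_normZ quot_norm_eq0.

Lemma rnorm_quotE (u : quot_alg) : rnorm u = quot_rnorm u.
Proof. by []. Qed.

(** The differences of a fast Cauchy sequence lift to a fast convergent series. *)
Lemma quot_complete (F : set_system quot_alg) :
  ProperFilter F -> cauchy F -> cvg F.
Proof.
have half0 : 0 <= 2^-1 :> R by [].
have half1 : 2^-1 < 1 :> R by rewrite invf_lt1// ltr1n.
apply: (@complete_of_geometric _ _ 6) => // u ustep.
have /choice[d dP] n : exists x, quot_proj x = u n.+1 - u n /\
    rnorm x <= 3 * 2^-1 ^+ n.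
  have q0 : 0 < 2^-1 ^+ n :> R by rewrite exprn_gt0// invr_gt0.
  have [x xu lx] := quot_rnorm_lift (u n.+1 - u n) q0.
  exists x; split=> //; have := ustep n; rewrite rnorm_quotE; lra.
pose v n := quot_lift (u 0%N) + \sum_(j < n) d j.
have vS n : v n.+1 = v n + d n by rewrite /v big_ord_recr/= addrA.
have vu n : quot_proj (v n) = u n.
  elim: n => [|n ih]; first by rewrite /v big_ord0 addr0 quot_liftK.
  by rewrite vS quot_projD ih (dP n).1 addrC subrK.
have [|l lP] := geometric_cvg (u := v) half0 half1 (ler0n R 3).
  by move=> n; rewrite vS addrC addKr (dP n).2.
have C6 : 3 / (1 - 2^-1) = 6 :> R by field.
exists (quot_proj l) => n; rewrite -vu -quot_projB.
by apply: le_trans (quot_rnorm_le _) _; rewrite -C6.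
Qed.

HB.instance Definition _ := Uniform_isComplete.Build quot_alg quot_complete.

Definition quot_cmul (u v : quot_alg) := quot_proj (quot_lift u · quot_lift v).
Definition quot_star (u : quot_alg) := quot_proj (cstar (quot_lift u)).

Lemma quot_projM0 x y :
  quot_proj (x · y) = quot_cmul (quot_proj x) (quot_proj y).
Proof.
have D_id := cidealP D; apply/esym/quot_proj_eq.
set x' := quot_lift _; set y' := quot_lift _.
have -> : x' · y' - x · y = (x' - x) · y' + x · (y' - y).
  by rewrite cmulBl cmulBr addrA subrK.
apply: idealD => //; [apply: idealMr|apply: idealMl] => //; exact: quot_liftP.
Qed.

Lemma quot_projS0 x : quot_proj (cstar x) = quot_star (quot_proj x).
Proof.
apply/esym/quot_proj_eq; rewrite -cstarB.
by apply: ideal_cstar; [exact: cidealP | exact: quot_liftP].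
Qed.

Lemma quot_cmulA : associative quot_cmul.
Proof.
elim/quot_ind=> x; elim/quot_ind=> y; elim/quot_ind=> z.
by rewrite -!quot_projM0 cmulA.
Qed.

Lemma quot_cmulDl : left_distributive quot_cmul +%R.
Proof.
elim/quot_ind=> x; elim/quot_ind=> y; elim/quot_ind=> z.
by rewrite -quot_projD -!quot_projM0 cmulDl quot_projD.
Qed.

Lemma quot_cmulDr : right_distributive quot_cmul +%R.
Proof.
elim/quot_ind=> x; elim/quot_ind=> y; elim/quot_ind=> z.
by rewrite -quot_projD -!quot_projM0 cmulDr quot_projD.
Qed.

Lemma quot_cmulZl (c : R[i]) u v : quot_cmul (c *: u) v = c *: quot_cmul u v.
Proof.
elim/quot_ind: u => x; elim/quot_ind: v => y.
by rewrite -quot_projZ -!quot_projM0 cmulZl quot_projZ.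
Qed.

Lemma quot_cmulZr (c : R[i]) u v : quot_cmul u (c *: v) = c *: quot_cmul u v.
Proof.
elim/quot_ind: u => x; elim/quot_ind: v => y.
by rewrite -quot_projZ -!quot_projM0 cmulZr quot_projZ.
Qed.

Lemma quot_starD u v : quot_star (u + v) = quot_star u + quot_star v.
Proof.
elim/quot_ind: u => x; elim/quot_ind: v => y.
by rewrite -quot_projD -!quot_projS0 cstarD quot_projD.
Qed.

Lemma quot_starZ (c : R[i]) u : quot_star (c *: u) = Num.conj c *: quot_star u.
Proof.
by elim/quot_ind: u => x; rewrite -quot_projZ -!quot_projS0 cstarZ quot_projZ.
Qed.

Lemma quot_starM u v : quot_star (quot_cmul u v) = quot_cmul (quot_star v) (quot_star u).
Proof.
elim/quot_ind: u => x; elim/quot_ind: v => y.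
by rewrite -quot_projM0 -!quot_projS0 -quot_projM0 cstarM.
Qed.

Lemma quot_starK : involutive quot_star.
Proof. by elim/quot_ind=> x; rewrite -!quot_projS0 cstarK. Qed.

Lemma quot_rnormM u v : quot_rnorm (quot_cmul u v) <= quot_rnorm u * quot_rnorm v.
Proof.
apply/ler_addgt0Pr => e e0.
set p := quot_rnorm u; set q := quot_rnorm v.
have p0 : 0 <= p by exact: quot_rnorm_ge0.
have q0 : 0 <= q by exact: quot_rnorm_ge0.
have S0 : 0 < p + q + 1 by rewrite ltr_wpDl// addr_ge0.
(* Then [(p + t) (q + t) <= p q + t (p + q + 1) <= p q + e]. *)
pose t := Num.min 1 (e / (p + q + 1)).
have t0 : 0 < t by rewrite /t lt_min ltr01 divr_gt0.
have t1 : t <= 1 by rewrite /t ge_min lexx.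
have te : t * (p + q + 1) <= e.
  by rewrite -ler_pdivlMr// /t ge_min lexx orbT.
have [x xu lx] := quot_rnorm_lift u t0; have [y yv ly] := quot_rnorm_lift v t0.
rewrite -xu -yv -quot_projM0 (le_trans (quot_rnorm_le _))//.
rewrite (le_trans (rnormM _ _))//.
have : rnorm x * rnorm y <= (p + t) * (q + t).
  by apply: ler_pM; rewrite ?rnorm_ge0// ltW.
have tt : t * t <= t * 1 by apply: ler_wpM2l => //; exact: ltW.
lra.
Qed.

Lemma quot_rnorm_star u : quot_rnorm (quot_star u) = quot_rnorm u.
Proof.
suff le v : quot_rnorm (quot_star v) <= quot_rnorm v.
  by apply/le_anti; rewrite le -{1}[u]quot_starK le.
apply/ler_addgt0Pr => e e0; have [x xv lx] := quot_rnorm_lift v e0.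
rewrite -{1}xv -quot_projS0 (le_trans (quot_rnorm_le _))//.
by rewrite rnorm_cstar ltW.
Qed.

(** For [y = x x^* + d] with [d] in [D], take [a] in [D] with [1 + a] contractive
    and [d + a d] small.  The class of [x] is that of [x + a x], and
    [|x + a x|^2 <= |x x^* + a x x^*| <= |y + a y| + |d + a d|]. *)
Lemma quot_rnorm_Mstar u : quot_rnorm u ^+ 2 <= quot_rnorm (quot_cmul u (quot_star u)).
Proof.
have D_id := cidealP D.
elim/quot_ind: u => x; rewrite -quot_projS0 -quot_projM0.
apply/ler_addgt0Pr => e e0; have e20 : 0 < e / 2 by rewrite divr_gt0.
have [y yx ly] := quot_rnorm_lift (quot_proj (x · cstar x)) e20.
have /quot_proj_eq Dd := yx; set d := y - _ in Dd.
have [a [aD a_contr ad]] := approximate_unit_at d e20.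
have Da : cideal_set D a by apply: aD => //; exact: idealMr.
have -> : quot_proj x = quot_proj (x + a · x).
  apply/esym/quot_proj_eq. rewrite addrC addKr.
  exact: idealMr.
apply: (@le_trans _ _ (rnorm (x + a · x) ^+ 2)).
  by rewrite ler_pXn2r ?nnegrE ?quot_rnorm_ge0 ?rnorm_ge0// quot_rnorm_le.
rewrite -rnorm_Mstar cmulDl -cmulA (le_trans (a_contr _))//.
rewrite -rnorm_cstar cstarM cstarK cmulDl -cmulA.
have xxE : x · cstar x = y - d by rewrite /d opprB addrC subrK.
clearbody d; have -> : x · cstar x + a · (x · cstar x) = (y + a · y) - (d + a · d).
  by rewrite xxE cmulBr opprD [RHS]addrACA.
rewrite (le_trans (rnormB _ _))// [e]splitr addrA lerD ?(ltW ad)//.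
by rewrite (le_trans (a_contr _))// ltW.
Qed.

Lemma quot_norm_Mle u v : quot_norm (quot_cmul u v) <= quot_norm u * quot_norm v.
Proof. by rewrite /quot_norm -rmorphM/= lecR quot_rnormM. Qed.

Lemma quot_norm_star u : quot_norm (quot_cmul (quot_star u) u) = quot_norm u ^+ 2.
Proof.
rewrite /quot_norm -rmorphXn/=; congr (_%:C); apply/le_anti/andP; split.
  by rewrite (le_trans (quot_rnormM _ _))// quot_rnorm_star expr2.
by rewrite -quot_rnorm_star (le_trans (quot_rnorm_Mstar _))// quot_starK.
Qed.

HB.instance Definition _ :=
  CompleteNormedModule_isCStarAlgebra.Build R quot_alg
    quot_cmulA quot_cmulDl quot_cmulDr quot_cmulZl quot_cmulZr quot_starD
    quot_starZ quot_starM quot_starK quot_norm_Mle quot_norm_star.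

Lemma quot_projM x y : quot_proj (x · y) = quot_proj x · quot_proj y.
Proof. exact: quot_projM0. Qed.

Lemma quot_projS x : quot_proj (cstar x) = cstar (quot_proj x).
Proof. exact: quot_projS0. Qed.

Lemma quot_proj_star_hom : star_hom quot_proj.
Proof.
split=> [x y _ _|c x _|x y _ _|x _]; [exact: quot_projD|exact: quot_projZ| |].
  exact: quot_projM.
exact: quot_projS.
Qed.

End QuotientAlgebra.

(** * Partial actions on an invariant ideal and on the quotient *)

Section PartialActionBasics.
Context (G : finGroupType) (R : realType) (S : pasystem G R).
Implicit Types (g h : G) (x y : S).

Lemma padom_ideal g : closed_ideal (padom g : set S).
Proof. exact: pdom_ideal. Qed.

Lemma padom_one x : padom 1%g x.
Proof. by rewrite /padom pdom1. Qed.

Lemma paact_hom g : star_hom_on (padom g^-1%g) (paact g : S -> S).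
Proof. exact: pact_hom. Qed.

Lemma paact_mem g x : padom g^-1%g x -> padom g (paact g x).
Proof. by have [+ _ _] := pact_bij (paction S) g; apply. Qed.

Lemma paact_surj g y : padom g y -> exists2 x, padom g^-1%g x & paact g x = y.
Proof. by have [_ _] := pact_bij (paction S) g; apply. Qed.

Lemma paactK g x : padom g^-1%g x -> paact g^-1%g (paact g x) = x.
Proof.
move=> gx; have [|_] := pactM (p := paction S) (g := g^-1%g) gx.
  by rewrite invgK; exact: paact_mem.
by rewrite mulVg pact1.
Qed.

Lemma paact_inv_mem g x : padom g x -> padom g^-1%g (paact g^-1%g x).
Proof. by move=> gx; apply: paact_mem; rewrite invgK. Qed.

Lemma paactVK g x : padom g x -> paact g (paact g^-1%g x) = x.
Proof. by move=> gx; rewrite -{1}[g]invgK paactK// invgK. Qed.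

(** [x] is the image under [h] of some [w], so [g x] is the image of [w] under
    [g h]. *)
Lemma paact_translate g h x :
  padom h x -> padom g^-1%g x -> padom (g * h)%g (paact g x).
Proof.
move=> hx gx; have [w hw wx] := paact_surj hx.
have gw : padom g^-1%g (paact h w) by rewrite wx.
have [ghw] := pactM (p := paction S) hw gw.
by rewrite -/(paact h w) wx -/(paact g x) => <-; exact: paact_mem.
Qed.

Lemma paact_contr g x : padom g^-1%g x -> rnorm (paact g x) <= rnorm x.
Proof. exact: (star_hom_contr (padom_ideal _) (paact_hom g)). Qed.

Lemma paact_invariantV (D : set S) g x : pa_invariant D ->
  padom g^-1%g x -> D (paact g x) -> D x.
Proof.
move=> D_inv gx Dgx; rewrite -(paactK gx); apply: D_inv => //.
by rewrite invgK; exact: paact_mem.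
Qed.

Lemma padomI_ideal (tau : {set G}) : closed_ideal (padomI tau : set S).
Proof.
split=> [||x y tx ty g gt|c x tx g gt|a x tx g gt|a x tx g gt].
- by apply: closed_bigI => g _; exact: ideal_closed (padom_ideal g).
- by move=> g _; exact: (ideal0 (padom_ideal g)).
- by apply: (idealD (padom_ideal g)); [exact: tx|exact: ty].
- by apply: (idealZ (padom_ideal g)); exact: tx.
- by apply: (idealMl (padom_ideal g)); exact: tx.
- by apply: (idealMr (padom_ideal g)); exact: tx.
Qed.

End PartialActionBasics.

Section Restriction.
Context (G : finGroupType) (R : realType) (S : pasystem G R) (D : cideal S).
Hypothesis D_inv : pa_invariant D.
Local Notation B := (ideal_alg D).

Definition res_dom (g : G) : set B := [set x | padom g (ideal_val x)].

(** 0 is a default value; on the domain the image stays in [D] by invariance. *)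
Definition res_act (g : G) (x : B) : B :=
  if pselect (cideal_set D (paact g (ideal_val x))) is left Dgx
  then ideal_elt Dgx else 0.

Lemma res_actE g x : res_dom g^-1%g x ->
  ideal_val (res_act g x) = paact g (ideal_val x).
Proof.
move=> gx; rewrite /res_act; case: pselect => //; case.
by apply: D_inv => //; exact: ideal_val_mem.
Qed.

Lemma res_dom_ideal g : closed_ideal (res_dom g).
Proof.
have g_id := padom_ideal S g.
split=> [||x y|c x|a x|a x]; rewrite /res_dom/=.
- apply/closed_rnormP => x xlim; apply: (ideal_lim g_id) => e e0.
  by have [y gy xy] := xlim e e0; exists (ideal_val y).
- exact: (ideal0 g_id).
- exact: (idealD g_id).
- exact: (idealZ g_id).
- exact: (idealMl g_id).
- exact: (idealMr g_id).
Qed.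

Lemma res_act_bij g : set_bij (res_dom g^-1%g) (res_dom g) (res_act g).
Proof.
split=> [x gx|x y /set_mem gx /set_mem gy xy|y gy].
- by rewrite /res_dom/= res_actE//; exact: paact_mem.
- apply: ideal_val_inj; rewrite -(paactK gx) -(paactK gy).
  by rewrite -res_actE// xy res_actE.
- have Dx : cideal_set D (paact g^-1%g (ideal_val y)).
    by apply: D_inv; [exact: ideal_val_mem|rewrite invgK].
  exists (ideal_elt Dx); first exact: paact_inv_mem.
  apply: ideal_val_inj; rewrite res_actE; last exact: paact_inv_mem.
  exact: paactVK.
Qed.

Lemma res_act_hom g : star_hom_on (res_dom g^-1%g) (res_act g).
Proof.
have gid := res_dom_ideal g^-1%g; have h := paact_hom S g.
split=> [x y gx gy|c x gx|x y gx gy|x gx]; apply: ideal_val_inj.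
- rewrite res_actE; last exact: idealD.
  by rewrite !ideal_valD (star_homD h)// !res_actE.
- rewrite res_actE; last exact: idealZ.
  by rewrite !ideal_valZ (star_homZ h)// !res_actE.
- rewrite res_actE; last exact: idealMl.
  by rewrite (star_homM h)// /cmul/= !res_actE.
- rewrite res_actE; last exact: ideal_cstar.
  by rewrite (star_homS h)// /cstar/= res_actE.
Qed.

Lemma res_act1 x : res_act 1%g x = x.
Proof.
apply: ideal_val_inj; rewrite res_actE ?/paact ?pact1//.
by rewrite /res_dom/= invg1; exact: padom_one.
Qed.

Lemma res_dom1 : res_dom 1%g = setT.
Proof. by apply/seteqP; split=> // x _; exact: padom_one. Qed.

Lemma res_actM g h x : res_dom h^-1%g x -> res_dom g^-1%g (res_act h x) ->
  res_dom ((g * h)^-1)%g x /\ res_act (g * h)%g x = res_act g (res_act h x).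
Proof.
move=> hx gx; have gx' : padom g^-1%g (paact h (ideal_val x)).
  by rewrite -res_actE.
have [ghx ghE] := pactM (p := paction S) hx gx'.
by split=> //; apply: ideal_val_inj; rewrite !res_actE.
Qed.

Definition res_action : partial_action G B :=
  PartialAction res_dom_ideal res_act_bij res_act_hom res_dom1 res_act1 res_actM.

Definition res_system : pasystem G R := PASystem res_action.

End Restriction.

Section QuotientAction.
Context (G : finGroupType) (R : realType) (S : pasystem G R) (D : cideal S).
Hypothesis D_inv : pa_invariant D.
Local Notation B := (quot_alg D).
Local Notation p := (@quot_proj R S D).

Definition quo_dom (g : G) : set B := p @` padom g.

(** The class of the image of a representative in the domain; by [quo_actE] all
    such representatives give the same class. *)
Definition quo_act (g : G) (u : B) : B :=
  if pselect (exists2 x : S, padom g^-1%g x & p x = u) is left ex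
  then p (paact g (sval (cid2 ex))) else 0.

Lemma quo_actE g x : padom g^-1%g x -> quo_act g (p x) = p (paact g x).
Proof.
move=> gx; rewrite /quo_act; case: pselect => [ex|]; last by case; exists x.
case: cid2 => y gy /= /quot_proj_eq Dyx; apply/quot_proj_eq.
have gid := padom_ideal S g^-1%g.
rewrite -(star_homB gid (paact_hom S g))//; apply: D_inv => //.
exact: idealB.
Qed.

(** Closedness is that of [padom g + D]. *)
Lemma quo_dom_ideal g : closed_ideal (quo_dom g).
Proof.
have g_id := padom_ideal S g; have D_id := cidealP D.
split=> [||_ _ [x gx <-] [y gy <-]|c _ [x gx <-]|a _ [x gx <-]|a _ [x gx <-]].
- apply/closed_rnormP; elim/quot_ind=> x xlim.
  suff [y gy Dxy] : ideal_sum (padom g) D x.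
    by exists y => //; apply/esym/quot_proj_eq.
  apply: ideal_lim; first exact: closed_ideal_sum.
  move=> e e0; have [_ [y gy <-]] := xlim e e0.
  rewrite -quot_projB rnorm_quotE => lt_e.
  have d0 : 0 < e - quot_rnorm (p (x - y)) by rewrite subr_gt0.
  have [z zxy lz] := quot_rnorm_lift (p (x - y)) d0.
  exists (x - z); last by rewrite opprB addrC subrK; lra.
  exists y => //; rewrite addrAC; exact/quot_proj_eq/esym.
- by exists 0; [exact: ideal0|exact: quot_proj0].
- by exists (x + y); [exact: idealD|exact: quot_projD].
- by exists (c *: x); [exact: idealZ|exact: quot_projZ].
- elim/quot_ind: a => a.
  by exists (a · x); [exact: idealMl|exact: quot_projM].
- elim/quot_ind: a => a.
  by exists (x · a); [exact: idealMr|exact: quot_projM].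
Qed.

Lemma quo_act_bij g : set_bij (quo_dom g^-1%g) (quo_dom g) (quo_act g).
Proof.
have gid := padom_ideal S g^-1%g.
split=> [_ [x gx <-]|_ _ /set_mem[x gx <-] /set_mem[y gy <-]|_ [y gy <-]].
- by rewrite quo_actE//; exists (paact g x) => //; exact: paact_mem.
- rewrite !quo_actE// => /quot_proj_eq Dxy; apply/quot_proj_eq.
  apply: (paact_invariantV D_inv (g := g)); first exact: idealB.
  by rewrite (star_homB gid (paact_hom S g)).
- have [x gx xy] := paact_surj gy; exists (p x); first by exists x.
  by rewrite quo_actE// xy.
Qed.

Lemma quo_act_hom g : star_hom_on (quo_dom g^-1%g) (quo_act g).
Proof.
have gid := padom_ideal S g^-1%g; have h := paact_hom S g.
split=> [_ _ [x gx <-] [y gy <-]|c _ [x gx <-]|_ _ [x gx <-] [y gy <-]|_ [x gx <-]].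
- rewrite -quot_projD !quo_actE//; last exact: idealD.
  by rewrite (star_homD h)// quot_projD.
- rewrite -quot_projZ !quo_actE//; last exact: idealZ.
  by rewrite (star_homZ h)// quot_projZ.
- rewrite -quot_projM !quo_actE//; last exact: idealMl.
  by rewrite (star_homM h)// quot_projM.
- rewrite -quot_projS !quo_actE//; last exact: ideal_cstar.
  by rewrite (star_homS h)// quot_projS.
Qed.

Lemma quo_act1 u : quo_act 1%g u = u.
Proof.
elim/quot_ind: u => x; rewrite quo_actE ?/paact ?pact1//.
by rewrite invg1; exact: padom_one.
Qed.

Lemma quo_dom1 : quo_dom 1%g = setT.
Proof.
apply/seteqP; split=> //; elim/quot_ind=> x _.
by exists x => //; exact: padom_one.
Qed.

(** A representative [x] of [u] in the domain of [h] may have an image outside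
    the domain of [g].  By [ideal_sum_cap] the image is congruent modulo [D] to
    some [c] in both ranges, and pulling [c] back by [h] corrects [x]. *)
Lemma quo_actM g h u : quo_dom h^-1%g u -> quo_dom g^-1%g (quo_act h u) ->
  quo_dom ((g * h)^-1)%g u /\ quo_act (g * h)%g u = quo_act g (quo_act h u).
Proof.
case=> x hx <-; rewrite quo_actE//; case=> y gy /quot_proj_eq Dyx.
have [c [gc hc] Dyc] := ideal_sum_cap (padom_ideal _ _) (padom_ideal _ _) (cidealP D)
  gy (paact_mem hx) Dyx.
have Dc : cideal_set D (c - paact h x).
  rewrite -(subrKA y) -[c - y]opprB; apply: (idealD (cidealP D)) => //.
  exact: (idealN (cidealP D)).
pose x' := paact h^-1%g c.
have hx' : padom h^-1%g x' by exact: paact_inv_mem.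
have x'c : paact h x' = c by exact: paactVK.
have xx' : p x = p x'.
  apply/esym/quot_proj_eq; apply: (paact_invariantV D_inv (g := h)).
    exact: (idealB (padom_ideal _ _)).
  by rewrite (star_homB (padom_ideal _ _) (paact_hom S h))// x'c.
have gx' : padom g^-1%g (paact h x') by rewrite x'c.
have [ghx ghE] := pactM (p := paction S) hx' gx'.
rewrite -quo_actE// xx' !quo_actE//; split; first by exists x'.
by congr p.
Qed.

Definition quo_action : partial_action G B :=
  PartialAction quo_dom_ideal quo_act_bij quo_act_hom quo_dom1 quo_act1 quo_actM.

Definition quo_system : pasystem G R := PASystem quo_action.

(** Induction on the number of ideals, with [ideal_sum_cap] as the step. *)
Lemma quo_padomI (tau : {set G}) (u : quo_system) :
  padomI tau u -> exists2 x, padomI tau x & p x = u.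
Proof.
move=> tu.
suff h (s : seq G) : {subset s <= tau} ->
    exists2 x, (forall g, g \in s -> padom g x) & p x = u.
  have [|x sx xu] := h (enum tau); first by move=> g; rewrite mem_enum.
  by exists x => // g gt; apply: sx; rewrite mem_enum.
have cap_ideal (r : seq G) :
    closed_ideal [set x : S | forall g, g \in r -> padom g x].
  rewrite (_ : [set x | _] = padomI [set g in r]%SET); first exact: padomI_ideal.
  apply/seteqP; split=> x xs g; first by rewrite /= inE; exact: xs.
  by move=> gs; apply: xs; rewrite /= inE.
elim: s => [|g s ih] gs_tau.
  by exists (quot_lift u) => //; exact: quot_liftK.
have [|x sx xu] := ih; first by move=> h hs; rewrite gs_tau// inE hs orbT.
have [y gy yu] : quo_dom g u by apply: tu; rewrite /= gs_tau// inE eqxx.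
have /quot_proj_eq Dyx : p y = p x by rewrite yu.
have [c [gc sc] Dyc] :=
  ideal_sum_cap (padom_ideal S g) (cap_ideal s) (cidealP D) gy sx Dyx.
exists c; last by rewrite -yu; apply/esym/quot_proj_eq.
by move=> h; rewrite inE => /predU1P[->//|]; exact: sc.
Qed.

Lemma ideal_extension : @equivariant_extension G R (res_system D_inv) S quo_system
  (@ideal_val R S D) p.
Proof.
have rangeE : range (@ideal_val R S D) = cideal_set D.
  apply/seteqP; split=> [_ [x _ <-]|x Dx]; first exact: ideal_val_mem.
  by exists (ideal_elt Dx).
split.
- exact: ideal_val_star_hom.
- exact: ideal_val_inj.
- exact: quot_proj_star_hom.
- apply/seteqP; split=> // u _; exists (quot_lift u) => //; exact: quot_liftK.
- by rewrite rangeE; apply/seteqP; split=> x /quot_proj_eq0.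
- by rewrite rangeE; exact: cidealP.
- by rewrite rangeE.
- move=> g; rewrite rangeE; apply/seteqP; split=> [_ [x gx <-]|x [Dx gx]].
    by split=> //; exact: ideal_val_mem.
  by exists (ideal_elt Dx).
- by move=> g x gx; exact: res_actE.
- by [].
- by move=> g x gx; rewrite -quo_actE.
Qed.

End QuotientAction.

(** * Peeling off the top layer *)

Section IdealSums.
Context (R : realType) (A : cstarAlgType R).

Lemma ideal_bigsum (I : set A) (T : finType) (P : pred T) (x : T -> A) :
  closed_ideal I -> (forall t, P t -> I (x t)) -> I (\sum_(t | P t) x t).
Proof.
move=> I_id Ix; apply: (big_ind I) => //; first exact: ideal0.
by move=> y z; exact: idealD.
Qed.

Lemma cmul_sumr (T : finType) (P : pred T) (x : T -> A) (a : A) :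
  a · (\sum_(t | P t) x t) = \sum_(t | P t) a · x t.
Proof. by apply: big_morph => [y z|]; [exact: cmulDr|exact: cmulr0]. Qed.

Lemma cmul_suml (T : finType) (P : pred T) (x : T -> A) (a : A) :
  (\sum_(t | P t) x t) · a = \sum_(t | P t) x t · a.
Proof.
by apply: (big_morph (fun y => y · a)) => [y z|]; [exact: cmulDl|exact: cmul0r].
Qed.

Lemma closed_ideal_closure (X : set A) : X 0 ->
    (forall x y, X x -> X y -> X (x + y)) ->
    (forall (c : R[i]) x, X x -> X (c *: x)) ->
    (forall a x, X x -> X (a · x)) -> (forall a x, X x -> X (x · a)) ->
  closed_ideal (closure X).
Proof.
move=> X0 XD XZ XMl XMr.
have lip (f : A -> A) (K : R) : 0 <= K -> (forall x, X x -> X (f x)) ->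
    (forall x y, rnorm (f x - f y) <= K * rnorm (x - y)) ->
    forall x, closure X x -> closure X (f x).
  move=> K0 Xf f_lip x /closure_rnormP cx; apply/closure_rnormP => e e0.
  have K1 : 0 < K + 1 by rewrite ltr_wpDl.
  have [y Xy xy] := cx _ (divr_gt0 e0 K1).
  exists (f y); first exact: Xf.
  rewrite (le_lt_trans (f_lip _ _))//.
  rewrite (@le_lt_trans _ _ ((K + 1) * rnorm (x - y)))//.
    by rewrite ler_wpM2r ?rnorm_ge0// lerDl.
  by rewrite mulrC -ltr_pdivlMr.
split=> [||x y /closure_rnormP cx /closure_rnormP cy|c x|a x|a x].
- exact: closed_closure.
- exact: subset_closure.
- apply/closure_rnormP => e e0; have e20 : 0 < e / 2 by rewrite divr_gt0.
  have [x' Xx' xx'] := cx _ e20; have [y' Xy' yy'] := cy _ e20.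
  exists (x' + y'); first exact: XD.
  rewrite opprD addrACA (le_lt_trans (rnormD _ _))//.
  by rewrite [e]splitr ltrD.
- apply: (lip _ (complex.Re `|c|)); [|exact: XZ|].
    by rewrite normc_def/= sqrtr_ge0.
  by move=> y z; rewrite -scalerBr rnormZ.
- apply: (lip _ (rnorm a)); [exact: rnorm_ge0|exact: XMl|].
  by move=> y z; rewrite -cmulBr rnormM.
- apply: (lip (fun y => y · a) (rnorm a)); [exact: rnorm_ge0|by move=> y; exact: XMr|].
  by move=> y z; rewrite -cmulBl mulrC rnormM.
Qed.

End IdealSums.

Lemma star_hom_sum (R : realType) (A B : cstarAlgType R) (I : set A) (f : A -> B)
    (T : finType) (P : pred T) (x : T -> A) :
  closed_ideal I -> star_hom_on I f -> (forall t, P t -> I (x t)) ->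
  f (\sum_(t | P t) x t) = \sum_(t | P t) f (x t).
Proof.
move=> I_id f_hom Ix.
suff [] : I (\sum_(t | P t) x t) /\ f (\sum_(t | P t) x t) = \sum_(t | P t) f (x t) by [].
apply: (big_ind2 (fun y z => I y /\ f y = z)).
- by split; [exact: ideal0|exact: star_hom0 f_hom].
- move=> y _ y' _ [Iy <-] [Iy' <-]; split; first exact: idealD.
  exact: (star_homD f_hom).
- by move=> t /Ix.
Qed.

Definition vanishing (G : finGroupType) (R : realType) (n : nat)
    (S : pasystem G R) : Prop :=
  forall sigma, sigma \in ptuples G n -> padomI sigma = [set 0 : S].

Section Layer.
Context (G : finGroupType) (R : realType) (S : pasystem G R) (n : nat).
Implicit Types (tau : {set G}) (x y : S).

Definition layer : set S := closure (@sum_padomI G R S n).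

Lemma layer_ideal : closed_ideal layer.
Proof.
apply: closed_ideal_closure => [|_ _ [x xt <-] [y yt <-]|c _ [x xt <-]|a _ [x xt <-]|a _ [x xt <-]].
- exists (fun=> 0); last by rewrite big1.
  by move=> tau _; exact: (ideal0 (padomI_ideal _ _)).
- exists (x \+ y); last by rewrite -big_split.
  move=> tau taun; apply: (idealD (padomI_ideal _ _)); [exact: xt|exact: yt].
- exists (fun tau => c *: x tau); last by rewrite scaler_sumr.
  by move=> tau taun; apply: (idealZ (padomI_ideal _ _)); exact: xt.
- exists (fun tau => a · x tau); last by rewrite cmul_sumr.
  by move=> tau taun; apply: (idealMl (padomI_ideal _ _)); exact: xt.
- exists (fun tau => x tau · a); last by rewrite cmul_suml.
  by move=> tau taun; apply: (idealMr (padomI_ideal _ _)); exact: xt.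
Qed.

Lemma padomI_sub_sum tau x : tau \in ptuples G n -> padomI tau x ->
  @sum_padomI G R S n x.
Proof.
move=> taun tx; exists (fun rho => if rho == tau then x else 0).
  move=> rho rhon; case: eqP => [->//|_]; exact: (ideal0 (padomI_ideal _ _)).
by rewrite (bigD1 tau)//= eqxx big1 ?addr0// => rho /andP[_ /negPf->].
Qed.

Lemma padomI_sub_layer tau x : tau \in ptuples G n -> padomI tau x -> layer x.
Proof. by move=> taun tx; apply: subset_closure; exact: padomI_sub_sum tx. Qed.

(** [g |: tau] has [n.+1] elements. *)
Lemma vanishing_disjoint : vanishing n.+1 S ->
  forall tau g, tau \in ptuples G n -> g \notin tau ->
    padomI tau `&` padom g = [set 0 : S].
Proof.
move=> van tau g; rewrite inE => /andP[tau1 /eqP taun] gtau.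
apply/seteqP; split=> [x [tx gx]|_ ->]; last first.
  by split; [exact: (ideal0 (padomI_ideal _ _))|exact: (ideal0 (padom_ideal _ _))].
rewrite -(van (g |: tau)%SET).
  by move=> h /=; rewrite in_setU1 => /predU1P[->//|]; exact: tx.
by rewrite inE in_setU1 tau1 orbT cardsU1 gtau taun eqxx.
Qed.

(** The translate [g tau] contains 1 exactly if [g^-1] is in [tau]; otherwise
    [x] is 0. *)
Lemma paact_padomI tau g x : tau \in ptuples G n -> vanishing n.+1 S ->
  padomI tau x -> padom g^-1%g x -> layer (paact g x).
Proof.
move=> taun van tx gx; have [gtau|gtau] := boolP (g^-1%g \in tau); last first.
  have : (padomI tau `&` padom g^-1%g) x by [].
  rewrite vanishing_disjoint// => ->.
  rewrite (star_hom0 (padom_ideal S g^-1%g) (paact_hom S g)).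
  exact: ideal0 layer_ideal.
apply: (@padomI_sub_layer [set (g * h)%g | h in tau]%SET).
  move: taun; rewrite !inE => /andP[_ /eqP <-].
  rewrite card_imset ?eqxx ?andbT; last exact: mulgI.
  by apply/imsetP; exists g^-1%g => //; rewrite mulgV.
move=> _ /imsetP[h htau ->]; apply: paact_translate => //; exact: tx.
Qed.

(** An element of the layer in the domain of [g] must be approximated by sums
    whose terms are in this domain too: multiply approximating sums by a local
    approximate unit at [x], which lies in the domain. *)
Lemma layer_invariant : vanishing n.+1 S -> pa_invariant layer.
Proof.
move=> van g x /closure_rnormP xlim gx.
have gid := padom_ideal S g^-1%g; have L_id := layer_ideal.
apply: (ideal_lim L_id) => eps eps0.
have e30 : 0 < eps / 3 by rewrite divr_gt0.
have [e [eI e_contr ex]] := approximate_unit_at x e30.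
have ge : padom g^-1%g e by apply: eI => //; exact: idealMr.
have [_ [y yt <-] xy] := xlim _ e30.
have dom tau : tau \in ptuples G n -> padom g^-1%g (- (e · y tau)).
  by move=> _; apply: idealN => //; exact: idealMr.
pose z := \sum_(tau in ptuples G n) - (e · y tau).
have zE : z = - (e · \sum_(tau in ptuples G n) y tau) by rewrite /z cmul_sumr sumrN.
have gz : padom g^-1%g z by exact: ideal_bigsum.
exists (paact g z).
  rewrite (star_hom_sum gid (paact_hom S g) dom); apply: ideal_bigsum => // tau taun.
  apply: (paact_padomI taun van _ (dom tau taun)).
  by apply: (idealN (padomI_ideal _ _)); apply: (idealMl (padomI_ideal _ _)); exact: yt.
rewrite -(star_homB gid (paact_hom S g))//.
rewrite (le_lt_trans (paact_contr _))//; first exact: idealB.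
set w := \sum_(tau in _) y tau in zE xy.
have -> : x - z = (x + e · x) - e · (x - w).
  by rewrite zE opprK cmulBr opprB [RHS]addrA [x + _ + _]addrAC addrK.
rewrite (le_lt_trans (rnormB _ _))//.
have := rnorm_mul_contr e_contr (x - w); lra.
Qed.

End Layer.

Section Peeling.
Context (G : finGroupType) (R : realType) (S : pasystem G R) (n : nat).

Definition layer_cideal : cideal S := CIdeal (layer_ideal S n).

Section LayerExtension.
Hypothesis L_inv : pa_invariant layer_cideal.

Lemma vanishing_res m : vanishing m S -> vanishing m (res_system L_inv).
Proof.
move=> van sigma sigmam; apply/seteqP; split=> [x sx|_ ->]; last first.
  exact: (ideal0 (padomI_ideal _ _)).
apply: ideal_val_inj; suff : padomI sigma (ideal_val x) by rewrite van.
by move=> g gs; exact: sx.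
Qed.

Lemma layer_decomposition : vanishing n.+1 S ->
  decomposition_property n (res_system L_inv).
Proof.
move=> van; split; last by apply: vanishing_disjoint; exact: vanishing_res.
apply/seteqP; split=> // x _; apply/closure_rnormP => e e0.
have /closure_rnormP/(_ e e0)[_ [y yt <-] xy] := ideal_val_mem x.
have /choice[z zP] (tau : {set G}) : exists z : res_system L_inv,
    tau \in ptuples G n -> ideal_val z = y tau.
  have [taun|_] := boolP (tau \in ptuples G n); last by exists 0.
  have Ly : cideal_set layer_cideal (y tau).
    exact: padomI_sub_layer (yt _ taun).
  by exists (ideal_elt Ly).
exists (\sum_(tau in ptuples G n) z tau).
  exists z => // tau taun g gtau; rewrite /padom/= /res_dom/= zP//.
  exact: yt gtau.
suff zy : ideal_val (\sum_(tau in ptuples G n) z tau) =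
    \sum_(tau in ptuples G n) y tau by rewrite -zy in xy.
rewrite (big_morph _ (@ideal_valD _ _ _) (erefl _ : ideal_val 0 = 0)).
exact: eq_bigr.
Qed.

(** An element of an n-fold intersection in the quotient lifts to one of [S],
    which belongs to the layer. *)
Lemma vanishing_quo : vanishing n (quo_system L_inv).
Proof.
move=> sigma sigman; apply/seteqP; split=> [u /quo_padomI[x sx <-]|_ ->]; last first.
  exact: (ideal0 (padomI_ideal _ _)).
apply/quot_proj_eq0; exact: padomI_sub_layer sx.
Qed.

End LayerExtension.

(** One step of the construction as total data, so that it can be iterated; it
    is meaningful under the vanishing hypothesis only. *)
Record peeling := Peeling {
  peel_ker : pasystem G R ;
  peel_quo : pasystem G R ;
  peel_incl : peel_ker -> S ;
  peel_proj : S -> peel_quo ;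
  peelP : vanishing n.+1 S ->
    [/\ equivariant_extension peel_incl peel_proj,
        decomposition_property n peel_ker & vanishing n peel_quo] }.

Definition peel : peeling :=
  match pselect (pa_invariant layer_cideal) with
  | left L_inv => @Peeling (res_system L_inv) (quo_system L_inv) _ _
      (fun van => And3 (ideal_extension L_inv) (layer_decomposition L_inv van)
        (vanishing_quo L_inv))
  | right L_ninv => @Peeling S S id id
      (fun van => False_ind _ (L_ninv (layer_invariant van)))
  end.

End Peeling.

Lemma vanishing2_decomposition (G : finGroupType) (R : realType)
  (S : pasystem G R) : vanishing 2 S -> decomposition_property 1 S.
Proof.
move=> van; split; last exact: vanishing_disjoint.
apply/seteqP; split=> // x _; apply: (@padomI_sub_layer _ _ _ _ [set 1%g]%SET).
  by rewrite inE set11 cards1.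
by move=> g /set1P->; exact: padom_one.
Qed.

Section PeelingTower.
Context (G : finGroupType) (R : realType) (S : pasystem G R).
Local Notation N := #|G|.

(** [peeled m] is the system left after removing the top [m] layers, those of
    index [N], ..., [N - m + 1]. *)
Fixpoint peeled (m : nat) : pasystem G R :=
  if m is m'.+1 then peel_quo (peel (peeled m') (N - m')) else S.

Lemma peeled_vanishing m : (m <= N)%N -> vanishing (N - m).+1 (peeled m).
Proof.
elim: m => [_|m ih mN] /=.
  move=> sigma; rewrite subn0 inE => /andP[_ /eqP sN].
  by have := max_card (mem sigma); rewrite sN ltnn.
rewrite subnSK//; have [_ _] := peelP (peel (peeled m) (N - m)) (ih (ltnW mN)).
exact.
Qed.

(** For [k < N] the indices [(N - k.+1).+1] and [N - k] agree but are not
    convertible, hence the cast. *)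
Definition peeled_proj k : peeled (N - k.+1) -> peeled (N - k) :=
  match pselect ((N - k.+1).+1 = N - k)%N with
  | left e => fun x => ecast m (peeled m) e
      (peel_proj (peel (peeled (N - k.+1)) (N - (N - k.+1))) x)
  | right _ => fun=> 0
  end.

Definition peeling_tower : tower G R :=
  @Tower G R (fun k => peeled (N - k))
    (fun k => peel_ker (peel (peeled (N - k)) (N - (N - k))))
    (fun k => @peel_incl _ _ _ _ (peel (peeled (N - k.+1)) (N - (N - k.+1))))
    peeled_proj.

Lemma peeling_towerP : decomposition_tower S peeling_tower.
Proof.
have peelPk k : (0 < k <= N)%N -> _ :=
  fun kN => peelP (peel (peeled (N - k)) (N - (N - k)))
    (peeled_vanishing (leq_subr k N)).
have van k : (k <= N)%N -> vanishing k.+1 (peeled (N - k)).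
  by move=> kN; have := peeled_vanishing (leq_subr k N); rewrite subKn.
split.
- by rewrite /= subnn.
- move=> k /andP[k0 kN]; have [|ext _ _] := peelPk k.+1; first by [].
  rewrite /= /peeled_proj; case: pselect => [e|]; last by rewrite subnSK.
  by case: _ / e.
- move=> k /andP[k2 kN]; have [|_ dec _] := peelPk k; first by rewrite (ltnW k2).
  by move: dec; rewrite {1}subKn.
- by move=> k /andP[_ kN]; exact: van.
- by apply: vanishing2_decomposition; apply: van; apply/card_gt0P; exists 1%g.
Qed.

End PeelingTower.

Lemma tower_iterated_extension (G : finGroupType) (R : realType)
    (S : pasystem G R) (T : tower G R) : decomposition_tower S T ->
  iterated_extension (@decomposable G R) S.
Proof.
move=> TP; rewrite -(tower_top TP).
have N0 : (0 < #|G|)%N by apply/card_gt0P; exists 1%g.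
suff h k : (k < #|G|)%N -> iterated_extension (@decomposable G R) (tsys T k.+1).
  by rewrite -(prednK N0); apply: h; rewrite prednK.
elim: k => [_|k ih kN].
  by apply: iterated_base; exists 1%N => //; exact: tower_bottom TP.
apply: (iterated_step _ (ih (ltnW kN)) (tower_ext TP _)); last by [].
by exists k.+2 => //; apply: tower_ker TP _ _.
Qed.

(** * Rigidity of decomposition towers *)

(** Split an element [g] other than 1 off the index set. *)
Lemma decomposition_vanishing (G : finGroupType) (R : realType)
    (S : pasystem G R) (n : nat) :
  (0 < n)%N -> decomposition_property n S -> vanishing n.+1 S.
Proof.
move=> n0 [_ dis] sigma; rewrite inE => /andP[s1 /eqP sn].
have [g] : exists g, g \in (sigma :\ 1%g)%SET.
  apply/card_gt0P; have := cardsD1 1%g sigma; rewrite s1 sn add1n => -[<-].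
  exact: n0.
rewrite !inE => /andP[g1 gs].
apply/seteqP; split=> [x sx|_ ->]; last exact: (ideal0 (padomI_ideal _ _)).
rewrite -(dis (sigma :\ g)%SET g); last by rewrite !inE eqxx.
  by split; [move=> h /setD1P[_]; exact: sx|exact: sx].
rewrite !inE eq_sym g1 s1/=; apply/eqP.
by have := cardsD1 g sigma; rewrite gs sn add1n => -[].
Qed.

Section EquivariantContinuity.
Context (G : finGroupType) (R : realType) (S S' : pasystem G R) (f : S -> S').
Hypothesis f_eq : equivariant_hom f.

Lemma equivariant_layer n x : layer n x -> layer n (f x).
Proof.
have [f_hom f_dom _] := f_eq; have T_id := @closed_idealT _ S.
have L_id := layer_ideal S' n.
move=> /closure_rnormP xlim; apply: (ideal_lim L_id) => e e0.
have [_ [y yt <-] xy] := xlim e e0.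
exists (f (\sum_(tau in ptuples G n) y tau)).
  rewrite (star_hom_sum T_id f_hom)//; apply: ideal_bigsum => // tau taun.
  apply: (padomI_sub_layer taun) => g gt; apply: f_dom.
  by exists (y tau) => //; exact: yt gt.
rewrite -(star_homB T_id f_hom)//.
by apply: le_lt_trans xy; exact: (star_hom_contr T_id f_hom).
Qed.

End EquivariantContinuity.

Section ExtensionKernel.
Context (G : finGroupType) (R : realType) (D A B : pasystem G R).
Context (i : D -> A) (p : A -> B).
Hypothesis ext : equivariant_extension i p.

Lemma ext_incl_equivariant : equivariant_hom i.
Proof.
split; [exact: ext_incl_hom ext| |exact: ext_sub_act ext].
by move=> g; rewrite (ext_sub_dom ext) => x [].
Qed.

Lemma ext_incl_dom g d : padom g (i d) -> padom g d.
Proof.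
move=> gd; have : (i @` padom g) (i d) by rewrite (ext_sub_dom ext).
by case=> d' gd' /(ext_incl_inj ext) <-.
Qed.

Lemma ext_projB x y : p (x - y) = p x - p y.
Proof. exact: (star_homB (@closed_idealT _ A) (ext_proj_hom ext)). Qed.

Lemma ext_proj0P x : p x = 0 <-> range i x.
Proof. by rewrite (ext_exact ext). Qed.

Lemma ext_proj_dom g x : padom g x -> padom g (p x).
Proof. by move=> gx; rewrite -(ext_quo_dom ext); exists x. Qed.

(** The inclusion is equivariant, so it maps the kernel, which is its own n-th
    layer, into that of [A].  Conversely each [padomI tau] of [A] projects into
    the one of [B], which is 0, and the range is closed. *)
Lemma ext_kernel_layer n : decomposition_property n D -> vanishing n B ->
  range i = layer n.
Proof.
move=> [D_dec _] van; apply/seteqP; split=> [_ [d _ <-]|x].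
  by apply: (equivariant_layer ext_incl_equivariant); rewrite /layer D_dec.
move=> /closure_rnormP xlim; have i_id := ext_ideal ext.
apply: (ideal_lim i_id) => e e0; have [_ [y yt <-] xy] := xlim e e0.
exists (\sum_(tau in ptuples G n) y tau) => //; apply: ideal_bigsum => // tau taun.
apply/ext_proj0P; suff : padomI tau (p (y tau)) by rewrite van.
by move=> g gt; apply: ext_proj_dom; exact: yt gt.
Qed.

End ExtensionKernel.

Section InducedMaps.
Context (G : finGroupType) (R : realType) (D A B D' A' B' : pasystem G R).
Context (i : D -> A) (p : A -> B) (i' : D' -> A') (p' : A' -> B').
Hypotheses (ext : equivariant_extension i p).
Hypotheses (ext' : equivariant_extension i' p').
Context (f : A -> A').
Hypotheses (f_eq : equivariant_hom f).
Hypothesis (f_ker : forall x, range i x -> range i' (f x)).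

Lemma induced_quotient_map :
  exists2 h : B -> B', equivariant_hom h & forall x, h (p x) = p' (f x).
Proof.
have [f_hom f_dom f_act] := f_eq.
have /choice[s sK] u : exists x, p x = u.
  by have [x _ <-] : range p u; [rewrite (ext_proj_surj ext)|exists x].
have f_dom' g x : padom g x -> padom g (f x) by move=> gx; apply: f_dom; exists x.
pose h u := p' (f (s u)).
have hp x : h (p x) = p' (f x).
  apply/eqP; rewrite -subr_eq0 -(ext_projB ext').
  rewrite -(star_homB (@closed_idealT _ A) f_hom)//; apply/eqP.
  apply/(ext_proj0P ext'); apply: f_ker; apply/(ext_proj0P ext).
  by rewrite (ext_projB ext) sK subrr.
have p_hom := ext_proj_hom ext; have p'_hom := ext_proj_hom ext'.
have quo_domE g u : padom g u -> exists2 x, padom g x & p x = u.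
  by rewrite -(ext_quo_dom ext).
exists h => //; split.
- split=> [u v _ _|c u _|u v _ _|u _].
  + rewrite -[u]sK -[v]sK -(star_homD p_hom)// !hp.
    by rewrite (star_homD f_hom)// (star_homD p'_hom).
  + by rewrite -[u]sK -(star_homZ p_hom)// !hp (star_homZ f_hom)// (star_homZ p'_hom).
  + rewrite -[u]sK -[v]sK -(star_homM p_hom)// !hp.
    by rewrite (star_homM f_hom)// (star_homM p'_hom).
  + by rewrite -[u]sK -(star_homS p_hom)// !hp (star_homS f_hom)// (star_homS p'_hom).
- move=> g _ [u /quo_domE[x gx <-] <-]; rewrite hp.
  by apply: (ext_proj_dom ext'); exact: f_dom'.
- move=> g u /quo_domE[x gx <-].
  rewrite -(ext_quo_act ext)// !hp f_act// (ext_quo_act ext')//.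
  exact: f_dom'.
Qed.

Lemma induced_kernel_map :
  exists2 h : D -> D', equivariant_hom h & forall x, f (i x) = i' (h x).
Proof.
have [f_hom f_dom f_act] := f_eq.
have f_dom' g x : padom g x -> padom g (f x) by move=> gx; apply: f_dom; exists x.
have /choice[h hE] d : exists d', f (i d) = i' d'.
  by have [|d' _ <-] := f_ker (x := i d); [exists d|exists d'].
have [i_hom i_dom i_act] := ext_incl_equivariant ext.
have i'_hom := ext_incl_hom ext'; have i'_inj := ext_incl_inj ext'.
have h_dom g d : padom g d -> padom g (h d).
  move=> gd; apply: (ext_incl_dom ext'); rewrite -hE; apply: f_dom'.
  by apply: i_dom; exists d.
exists h => //; split; last 2 first.
- by move=> g _ [d gd <-]; exact: h_dom.
- move=> g d gd; apply: i'_inj; rewrite -hE i_act// f_act; last first.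
    by apply: i_dom; exists d.
  by rewrite hE (ext_sub_act ext')//; exact: h_dom.
split=> [u v _ _|c u _|u v _ _|u _]; apply: i'_inj; rewrite -hE.
- by rewrite (star_homD i_hom)// (star_homD f_hom)// !hE (star_homD i'_hom).
- by rewrite (star_homZ i_hom)// (star_homZ f_hom)// !hE (star_homZ i'_hom).
- by rewrite (star_homM i_hom)// (star_homM f_hom)// !hE (star_homM i'_hom).
- by rewrite (star_homS i_hom)// (star_homS f_hom)// !hE (star_homS i'_hom).
Qed.

End InducedMaps.

Section Canonicity.
Context (G : finGroupType) (R : realType).
Local Notation N := #|G|.

(** The quotient has vanishing k.+1-fold intersections: for [k = 1] this is the
    1-decomposition property of the bottom. *)
Lemma tower_kernel (S : pasystem G R) (T : tower G R) k :
  decomposition_tower S T -> (0 < k < N)%N -> range (@tincl G R T k) = layer k.+1.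
Proof.
move=> TP /andP[k0 kN].
apply: (ext_kernel_layer (tower_ext TP _)); first by rewrite k0.
  by apply: tower_ker TP _ _; rewrite ltnS k0.
have [k1|k2] := leqP k 1.
  have -> : k = 1%N by apply/eqP; rewrite eqn_leq k1.
  exact: decomposition_vanishing (tower_bottom TP).
by apply: (tower_vanish TP); rewrite k2 ltnW.
Qed.

Context (S S' : pasystem G R) (T T' : tower G R).
Hypotheses (TP : decomposition_tower S T) (TP' : decomposition_tower S' T').

Lemma tower_kernel_map k (f : tsys T k.+1 -> tsys T' k.+1) : (0 < k < N)%N ->
  equivariant_hom f -> forall x, range (@tincl G R T k) x ->
  range (@tincl G R T' k) (f x).
Proof.
move=> kN f_eq x; rewrite (tower_kernel TP kN) (tower_kernel TP' kN).
exact: equivariant_layer.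
Qed.

Context (phi : tsys T N -> tsys T' N).
Hypothesis phi_eq : equivariant_hom phi.

(** Downward induction on the index: a map at level [k.+1] preserves the kernels,
    so it induces one at level [k]. *)
Lemma tower_maps : exists f : forall k, tsys T k -> tsys T' k,
  [/\ f N = phi, forall k, (0 < k <= N)%N -> equivariant_hom (f k)
    & forall k, (0 < k < N)%N -> forall x, f k (tproj x) = tproj (f k.+1 x)].
Proof.
have N0 : (0 < N)%N by apply/card_gt0P; exists 1%g.
suff h j : (j < N)%N -> exists f : forall k, tsys T k -> tsys T' k,
  [/\ f N = phi, forall k, (N - j <= k <= N)%N -> equivariant_hom (f k)
    & forall k, (N - j <= k < N)%N -> forall x, f k (tproj x) = tproj (f k.+1 x)].
  by have := h N.-1; rewrite ltn_predL -subn1 subKn//; exact.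
elim: j => [_|j ih jN].
  pose f0 k : tsys T k -> tsys T' k := fun=> 0.
  exists (dfwith f0 _ phi); rewrite subn0 dfwithin; split=> // k.
    by rewrite -eqn_leq => /eqP <-; rewrite dfwithin.
  by case/andP=> Nk; rewrite ltnNge Nk.
have [f [fN f_eq f_proj]] := ih (ltnW jN).
set k := (N - j.+1)%N; have k0 : (0 < k)%N by rewrite subn_gt0.
have kS : k.+1 = (N - j)%N by rewrite /k subnSK// ltnW.
have kN : (k < N)%N by rewrite kS leq_subr.
have k0N : (0 < k < N)%N by rewrite k0.
have fk_eq : equivariant_hom (f k.+1) by apply: f_eq; rewrite -kS leqnn.
have [h h_eq hp] := induced_quotient_map (tower_ext TP k0N) (tower_ext TP' k0N)
  fk_eq (tower_kernel_map k0N fk_eq).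
exists (dfwith f _ h); split.
- by rewrite dfwithout// neq_ltn kN.
- move=> m /andP[km mN]; have [<-|km'] := eqVneq k m; first by rewrite dfwithin.
  by rewrite dfwithout//; apply: f_eq; rewrite mN -kS ltn_neqAle km' km.
- move=> m /andP[km mN] x; rewrite [dfwith f _ h m.+1]dfwithout; last first.
    by rewrite neq_ltn ltnS km.
  have [km'|km'] := eqVneq k m.
    by move: x mN; rewrite -km' dfwithin => x _; exact: hp.
  by rewrite dfwithout//; apply: f_proj; rewrite mN -kS ltn_neqAle km' km.
Qed.

(** Uniqueness holds because the projections are surjective and the inclusions
    injective. *)
Lemma tower_extends_uniquely : extends_uniquely phi.
Proof.
have [f [fN f_eq f_proj]] := tower_maps.
have ex_d k : exists d : tker T k.+1 -> tker T' k.+1, (0 < k < N)%N ->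
    equivariant_hom d /\ forall x, f k.+1 (tincl x) = tincl (d x).
  have [kN|_] := boolP (0 < k < N)%N; last by exists (fun=> 0).
  have fk_eq : equivariant_hom (f k.+1) by apply: f_eq; case/andP: kN.
  have [d d_eq dE] := induced_kernel_map (tower_ext TP kN) (tower_ext TP' kN)
    fk_eq (tower_kernel_map kN fk_eq).
  by exists d.
pose d k : tker T k -> tker T' k :=
  if k is k'.+1 then projT1 (cid (ex_d k')) else fun=> 0.
have dP k : (0 < k < N)%N ->
    equivariant_hom (d k.+1) /\ forall x, f k.+1 (tincl x) = tincl (d k.+1 x).
  exact: projT2 (cid (ex_d k)).
exists f, d; split.
- by rewrite fN.
- split=> // [[//|k] kN|k kN]; last exact: (dP k kN).2.
  by apply: (dP k _).1.
move=> f' d' f'N [_ _ f'_incl f'_proj].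
have f'f k : (0 < k <= N)%N -> f' k =1 f k.
  move=> /andP[k0 /subnKC]; move: (N - k)%N => j.
  elim: j k k0 => [|j ih] k k0 kN.
    by have kE : k = N; [rewrite -kN addn0 | subst k => x; rewrite fN].
  have kS : (k.+1 + j = N)%N by rewrite addSnnS.
  have kltN : (0 < k < N)%N by rewrite k0 -kS leq_addr.
  move=> x; have [y _ <-] : range (@tproj G R T k) x.
    by rewrite (ext_proj_surj (tower_ext TP kltN)).
  by rewrite f'_proj// f_proj// (ih k.+1).
split=> // -[//|k] kN x; apply: (ext_incl_inj (tower_ext TP' kN)).
rewrite -f'_incl// f'f; last by case/andP: kN.
by rewrite (dP k kN).2.
Qed.

End Canonicity.

Theorem theorem6p1 (G : finGroupType) (R : realType) (A : cstarAlgType R)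
    (alpha : partial_action G A) :
  [/\ exists T : tower G R, decomposition_tower (PASystem alpha) T,
      canonical_towers (PASystem alpha)
    & iterated_extension (@decomposable G R) (PASystem alpha)].
Proof.
have TP := peeling_towerP (PASystem alpha); split.
- by exists (peeling_tower (PASystem alpha)).
- by move=> S' T T' TP1 TP2 phi; exact: tower_extends_uniquely TP1 TP2 phi.
- exact: tower_iterated_extension TP.
Qed.
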